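(* Let $g_1,\dots,g_m\in\mathbb R[\mathbf x]$, let $\mathcal X=\{\mathbf x\in\mathbb R^n:g_i(\mathbf x)\le0\ \forall i\in[m]\}$ be non-empty and compact, and let $\Omega\subset\mathbb R^n$ be a compact convex set with $\mathcal X\subset\operatorname{int}\Omega$. Let $g(\mathbf x)=\max\{0,g_1(\mathbf x),\dots,g_m(\mathbf x)\}$. Assume that at least one of the following holds: (a) there is $\mu>0$ such that $g_i(\mathbf y)\ge g_i(\mathbf x)+\langle\nabla g_i(\mathbf x),\mathbf y-\mathbf x\rangle+\frac\mu2\|\mathbf y-\mathbf x\|^2$ for all $\mathbf x,\mathbf y\in\Omega$ and $i\in[m]$; (b) $g$ satisfies the Polyak-Łojasiewicz condition: there is $\mu>0$ such that $g(\mathbf x)-\inf_{\mathbb R^n}g\le\frac1{2\mu}\|\mathbf w\|^2$ for all $\mathbf x\in\mathbb R^n$ and all $\mathbf w\in\partial^Lg(\mathbf x)$. Then for each fixed $k$ the error of the truncated pseudo-moment sequences satisfies $\mathbf d_k(\mathcal R(\mathcal X)_{2r})=O(1/\sqrt r)$ as $r\to\infty$, and the convergence rate of the Schmüdgen-type moment-SOS hierarchy is $O(1/\sqrt r)$: for every $f\in\mathbb R[\mathbf x]$ with $f_{\min}=\min_{\mathcal X}f$, both $f_{\min}-\mathrm{mlb}(f,\mathcal R(\mathcal X))_r$ and $f_{\min}-\mathrm{lb}(f,\mathcal R(\mathcal X))_r$ are $O(1/\sqrt r)$.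
   Context: Subdifferentials: $\mathbf w\in\partial^Fg(\mathbf x)$ (Fréchet subdifferential) iff $\liminf_{\mathbf y\to\mathbf x}\frac{g(\mathbf y)-g(\mathbf x)-\langle\mathbf w,\mathbf y-\mathbf x\rangle}{\|\mathbf y-\mathbf x\|}\ge0$; $\mathbf w\in\partial^Lg(\mathbf x)$ (limiting subdifferential) iff there are $\mathbf x_n\to\mathbf x$ with $g(\mathbf x_n)\to g(\mathbf x)$ and $\mathbf w_n\in\partial^Fg(\mathbf x_n)$ with $\mathbf w_n\to\mathbf w$. Standing convention: for some $R\ge1$ with $\mathcal X\subset\mathbb B_R=\{\|\mathbf x\|\le R\}$, the redundant ball constraint is added to the description, i.e. $\mathcal X$ is described by $q_0=R^2-\|\mathbf x\|^2\ge0$ and $q_i=-g_i\ge0$, $i\in[m]$. There are no equality constraints, so the reduced certificate $\mathcal R(\mathcal X)_{2r}$ coincides with the truncated preordering $\mathcal T(\mathcal X)_{2r}$. Notation: $[m]=\{1,\dots,m\}$; $\lceil q\rceil=\lceil(\deg q)/2\rceil$; for $J\subset\{0,\dots,m\}$, $q_J=\prod_{j\in J}q_j$, $q_\emptyset=1$; $\Sigma[\mathbf x]_{2s}$ = sums of squares of degree $\le2s$; $\mathbb N^n_k=\{\alpha\in\mathbb N^n:|\alpha|\le k\}$. $\mathcal R(\mathcal X)_{2r}=\mathcal T(\mathcal X)_{2r}=\{\sum_{J,\lceil q_J\rceil\le r}\sigma_Jq_J:\sigma_J\in\Sigma[\mathbf x]_{2(r-\lceil q_J\rceil)}\}$; $\mathrm{lb}(f,\mathcal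 R(\mathcal X))_r=\sup\{a\in\mathbb R:f-a\in\mathcal R(\mathcal X)_{2r}\}$. For $y=(y_\alpha)_{\alpha\in\mathbb N^n_{2r}}$, $\ell_y(f)=\sum f_\alpha y_\alpha$, $\mathbf M_t(qy)=(\ell_y(q\,\mathbf x^{\alpha+\beta}))_{\alpha,\beta\in\mathbb N^n_t}$, $\mathbf M_t(y)=\mathbf M_t(1\,y)$; $\mathcal M(\mathcal R(\mathcal X)_{2r})=\{y:y_0=1,\mathbf M_r(y)\succeq0,\mathbf M_{r-\lceil q_J\rceil}(q_Jy)\succeq0\ \forall J\subset\{0,\dots,m\},\lceil q_J\rceil\le r\}$; $\mathrm{mlb}(f,\mathcal R(\mathcal X))_r=\inf\{\ell_y(f):y\in\mathcal M(\mathcal R(\mathcal X)_{2r})\}$. $\mathcal M_k(\mathcal R(\mathcal X)_{2r})$ is the image of $\mathcal M(\mathcal R(\mathcal X)_{2r})$ under restriction to indices in $\mathbb N^n_k$; $\mathcal M_k(\mathcal X)=\{(\int\mathbf x^\alpha d\nu)_{\alpha\in\mathbb N^n_k}:\nu\text{ a probability measure on }\mathcal X\}$; $\mathbf d_k(\mathcal R(\mathcal X)_{2r})=\sup\{\inf_{z\in\mathcal M_k(\mathcal X)}\|y-z\|:y\in\mathcal M_k(\mathcal R(\mathcal X)_{2r})\}$. *)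

(* Defs.v *)
From HB Require Import structures.
From mathcomp Require Import all_boot all_order all_algebra.
(* mpoly's notations clash with those of MathComp-Analysis, hence the filter.  *)
From mathcomp Require Import -(notations) mpoly.
From mathcomp Require Import all_classical all_reals all_analysis.

Set Implicit Arguments.
Unset Strict Implicit.
Unset Printing Implicit Defensive.

Import Order.TTheory GRing.Theory Num.Theory numFieldNormedType.Exports.

Local Open Scope classical_set_scope.
Local Open Scope ring_scope.

Notation "{ 'mpoly' T [ n ] }" := (mpoly n T)
  (at level 0, T, n at level 2, format "{ 'mpoly'  T [ n ] }").

(* The index set N^n_k of the exponents alpha with |alpha| <= k.               *)
Notation "''N_(' n , k )" := (bmultinom n k.+1)
  (at level 8, n, k at level 2, format "''N_(' n ,  k )") : type_scope.

Section Euclidean.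
Context (R : realType).

(* The library norm on 'rV[R]_n is the sup norm; its topology is the usual one,
   so it is used below for limits, compactness and interiors only.             *)
Definition norm2 (I : finType) (v : I -> R) : R := Num.sqrt (\sum_i v i ^+ 2).

Definition enorm n (x : 'rV[R]_n) : R := norm2 (x ord0).

Definition dotv n (x y : 'rV[R]_n) : R := \sum_(i < n) x ord0 i * y ord0 i.

End Euclidean.

Section Polynomials.
Context (R : realType) (n : nat).
Implicit Types p q : {mpoly R[n]}.

Definition peval p (x : 'rV[R]_n) : R := meval (x ord0) p.

Definition grad p (x : 'rV[R]_n) : 'rV[R]_n := \row_i peval (mderiv i p) x.

(* [mmeasure mdeg] is multinomials' [msize], that is, 1 + the degree.          *)
Definition deg p : nat := (mmeasure mdeg p).-1.

Definition half_deg p : nat := uphalf (deg p).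

Definition sos (s : nat) : set {mpoly R[n]} :=
  [set p | (deg p <= 2 * s)%N /\
           exists h : seq {mpoly R[n]}, p = \sum_(u <- h) u ^+ 2].

End Polynomials.

Section Subdifferentials.
Context (R : realType) (n : nat).
Implicit Types (g : 'rV[R]_n -> R) (x w : 'rV[R]_n).

Definition frechet_subdiff g x : set 'rV[R]_n :=
  [set w | (0 <= limf_einf
     (fun y => ((g y - g x - dotv w (y - x)) / enorm (y - x))%:E) x^')%E].

Definition limiting_subdiff g x : set 'rV[R]_n :=
  [set w | exists x_ w_ : nat -> 'rV[R]_n,
     [/\ x_ @ \oo --> x, (g \o x_) @ \oo --> g x,
         forall i, frechet_subdiff g (x_ i) (w_ i) & w_ @ \oo --> w]].

Definition polyak_lojasiewicz g : Prop :=
  exists2 mu : R, 0 < mu &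
    forall x w, limiting_subdiff g x w ->
      g x - inf (range g) <= (2 * mu)^-1 * enorm w ^+ 2.

End Subdifferentials.

Section FeasibleSet.
Context (R : realType) (n m : nat).
Implicit Types (g : 'I_m -> {mpoly R[n]}).

Definition feasible g : set 'rV[R]_n := [set x | forall i, peval (g i) x <= 0].

Definition max_violation g (x : 'rV[R]_n) : R :=
  \big[Num.max/0]_(i < m) peval (g i) x.

Definition strongly_convex_on (Omega : set 'rV[R]_n) g : Prop :=
  exists2 mu : R, 0 < mu &
    forall x y i, Omega x -> Omega y ->
      peval (g i) x + dotv (grad (g i) x) (y - x) + mu / 2 * enorm (y - x) ^+ 2
        <= peval (g i) y.

Definition ball_poly (rad : R) : {mpoly R[n]} :=
  mpolyC n (rad ^+ 2) - \sum_(i < n) mpolyX R (mnm1 i) ^+ 2.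

(* q_0 is the redundant ball constraint and q_(i+1) = - g_i for i : 'I_m.      *)
Definition constr (rad : R) g (j : 'I_m.+1) : {mpoly R[n]} :=
  if unlift ord0 j is Some i then - g i else ball_poly rad.

End FeasibleSet.

Section Hierarchy.
Context (R : realType) (n c : nat) (q : 'I_c -> {mpoly R[n]}).
Implicit Types (J : {set 'I_c}) (f : {mpoly R[n]}).

Definition prod_constr J : {mpoly R[n]} := \prod_(j in J) q j.

Definition preordering (r : nat) : set {mpoly R[n]} :=
  [set p | exists2 sigma : {set 'I_c} -> {mpoly R[n]},
     forall J, (half_deg (prod_constr J) <= r)%N ->
       sos (r - half_deg (prod_constr J)) (sigma J) &
     p = \sum_(J | (half_deg (prod_constr J) <= r)%N) sigma J * prod_constr J].

(* sup and inf are taken in \bar R: the sets may be empty for small r.         *)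
Definition lb f (r : nat) : \bar R :=
  ereal_sup [set a%:E | a in [set a : R | preordering r (f - mpolyC n a)]].

(* l_y(f), meaningful for deg f <= d: coefficients of degree > d are dropped.  *)
Definition riesz d (y : {ffun 'N_(n, d) -> R}) f : R :=
  \sum_(a : 'N_(n, d)) mcoeff a f * y a.

Definition moment_matrix d t (y : {ffun 'N_(n, d) -> R}) (p : {mpoly R[n]})
    (a b : 'N_(n, t)) : R :=
  riesz y (p * mpolyX R (mnm_add a b)).

Definition psd (I : finType) (M : I -> I -> R) : Prop :=
  (forall i j, M i j = M j i) /\
  forall v : I -> R, 0 <= \sum_i \sum_j v i * M i j * v j.

Definition pseudo_moments (r : nat) : set {ffun 'N_(n, 2 * r) -> R} :=
  [set y : {ffun 'N_(n, 2 * r) -> R} | [/\ y bm0 = 1,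
               psd (@moment_matrix (2 * r) r y 1) &
               forall J, (half_deg (prod_constr J) <= r)%N ->
                 psd (@moment_matrix (2 * r) (r - half_deg (prod_constr J)) y
                        (prod_constr J))]].
Arguments pseudo_moments : clear implicits.

Definition mlb f (r : nat) : \bar R :=
  ereal_inf [set (riesz y f)%:E | y in pseudo_moments r].

(* Restriction to N^n_k, which makes sense for k <= 2r: y_a = l_y(x^a).        *)
Definition truncated_pseudo_moments (k r : nat) : set {ffun 'N_(n, k) -> R} :=
  [set [ffun a : 'N_(n, k) => riesz y (mpolyX R a)] | y in pseudo_moments r].
Arguments truncated_pseudo_moments : clear implicits.

(* A probability measure on X is a Borel probability on R^n giving X mass 1.   *)
Definition true_moments (X : set 'rV[R]_n) (k : nat) :
    set {ffun 'N_(n, k) -> R} :=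
  [set [ffun a : 'N_(n, k) =>
          Rintegral nu X (fun x : 'rV[R]_n => peval (mpolyX R a) x)]
    | nu in [set nu : probability (g_sigma_algebraType (@open 'rV[R]_n)) R
              | nu X = 1%E]].
Arguments true_moments : clear implicits.

Definition moment_error (X : set 'rV[R]_n) (k r : nat) : \bar R :=
  ereal_sup
    [set ereal_inf [set (norm2 (fun a => y a - z a))%:E | z in true_moments X k]
      | y in truncated_pseudo_moments k r].

End Hierarchy.

Definition is_min (R : realType) (T : Type) (X : set T) (f : T -> R) (v : R) :
  Prop := (exists2 x, X x & f x = v) /\ forall x, X x -> v <= f x.

(* u_r = O(1/sqrt r); u may be infinite for finitely many r only.              *)
Definition O_invsqrt (R : realType) (u : nat -> \bar R) : Prop :=
  (\forall r \near \oo, u r \is a fin_num) /\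
  (fine \o u) =O_\oo (fun r : nat => (Num.sqrt (r%:R : R))^-1).

(* Main.v *)
Require Import Defs.
From HB Require Import structures.
From mathcomp Require Import all_boot all_order all_algebra.
From mathcomp Require Import -(notations) mpoly.
From mathcomp Require Import all_classical all_reals all_analysis.
From mathcomp Require Import measurable_realfun ring lra zify.

(* Effective certificates from a positive kernel and a growth condition.
   Both assumptions give dist(a, X)^2 <= c max(0, g_1(a), ..., g_m(a)) on the box
   [-rad, rad]^n. For a point a of the box write
     f - fmin = (f - f(a)) + (f(a) - fmin).
   By AM-GM f - f(a) >= - d/2 - L |x - a|^2 / (2 d); by growth and AM-GM
   f(a) - fmin >= - d/2 - (C / d) sum_i max(g_i(a), 0); and, since - g_i >= 0 is
   one of the constraints,
     max(g_i(a), 0) <= e/2 + (g_i(a) - g_i(x))^2 / (2 e).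
   The inequalities in x have certificates of bounded degree, so
   f - fmin + O(d + e/d) + O(1/d + 1/(d e)) |x - a|^2 is certified for every a.
   Averaging over a grid of nodes a with a tensor Jackson kernel, which
   lies in the preordering of the box, sums to 1 and has second moment O(1/N^2)
   at degree O(N), and taking d = 1/sqrt N, e = 1/N, certifies
   f - fmin + O(1/sqrt N) at order O(N), uniformly over bounded coefficients of f.
   Evaluating such certificates on pseudo-moments bounds the support function
   of the pseudo-moment set, whence the distance to the convex set of moments. *)

Set Implicit Arguments.
Unset Strict Implicit.
Unset Printing Implicit Defensive.

Import Order.TTheory GRing.Theory Num.Theory numFieldNormedType.Exports.

Local Open Scope classical_set_scope.
Local Open Scope ring_scope.

(** * Truncated certificates *)

(** The obstacle is that the nodes fill a box and not X: at an infeasible node f(a) may lie below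
    fmin, so a positive kernel alone certifies nothing. Growth limits the deficit to a multiple of
    the square root of the violation, and this square root sets the rate: in the total error d + e/d
    + (1/d + 1/(d e))/N^2 the terms d, e/d and 1/(d e N^2) all equal 1/sqrt N for the chosen d and
    e, and the remaining one is smaller. The kernel multiplies certificates that contain - g_i, so
    products of distinct constraints arise; the preordering absorbs them with orders that simply add
    up. Lipschitz bounds have to be certificates of an order independent of a: a mere inequality on
    the box could not be multiplied by the kernel inside the preordering. The grid is an exact
    quadrature: with enough equispaced angles the sums of cosines that occur vanish just as the
    integrals do, so the certificates involve finite sums only. *)

Lemma uphalf_leq_add a b c d : (a + a + b = c + d)%N ->
  (a + uphalf b <= uphalf c + uphalf d)%N.
Proof.
have [/= eb ec ed] := (odd_double_half b, odd_double_half c, odd_double_half d).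
rewrite !uphalf_half; lia.
Qed.

Section Degree.
Context (R : realType) (n : nat).
Implicit Types p q : {mpoly R[n]}.

Lemma degE p : deg p = (mmeasure mdeg p).-1. Proof. by []. Qed.

Lemma deg0 : deg (0 : {mpoly R[n]}) = 0%N.
Proof. by rewrite degE mmeasure0. Qed.

Lemma degC a : deg (mpolyC n a : {mpoly R[n]}) = 0%N.
Proof. by rewrite degE mmeasureC; case: (a != 0). Qed.

Lemma deg1 : deg (1 : {mpoly R[n]}) = 0%N.
Proof. by rewrite -mpolyC1 degC. Qed.

Lemma degX (m : multinom n) : deg (mpolyX R m) = mdeg m.
Proof. by rewrite degE mmeasureX. Qed.

Lemma degN p : deg (- p) = deg p.
Proof. by rewrite !degE mmeasureN. Qed.

Lemma degM p q : p * q != 0 -> deg (p * q) = (deg p + deg q)%N.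
Proof.
rewrite mulf_eq0 negb_or => /andP[p0 q0]; rewrite !degE msizeM //.
by rewrite (mpolySpred mdeg p0) (mpolySpred mdeg q0) addnS.
Qed.

Lemma degM_le p q : (deg (p * q)%R <= deg p + deg q)%N.
Proof.
have [->|/degM ->//] := eqVneq (p * q) 0; by rewrite deg0.
Qed.

Lemma degD_le p q : (deg (p + q)%R <= maxn (deg p) (deg q))%N.
Proof. rewrite !degE; have := mmeasureD_le mdeg p q; lia. Qed.

Lemma deg_add p q d : (deg p <= d)%N -> (deg q <= d)%N -> (deg (p + q)%R <= d)%N.
Proof. by move=> pd qd; apply: (leq_trans (degD_le _ _)); rewrite geq_max pd. Qed.

Lemma deg_sum (I : Type) (r : seq I) (P : pred I) (F : I -> {mpoly R[n]}) d :
  (forall i, P i -> (deg (F i) <= d)%N) ->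
  (deg (\sum_(i <- r | P i) F i)%R <= d)%N.
Proof.
move=> Fd; apply: (big_ind (fun p => deg p <= d)%N) => //.
- by rewrite deg0.
- by move=> p q; apply: deg_add.
Qed.

Lemma degX_le p d k : (deg p <= d)%N -> (deg (p ^+ k)%R <= k * d)%N.
Proof.
move=> pd; elim: k => [|k IH]; first by rewrite expr0 deg1.
by rewrite exprS mulSn (leq_trans (degM_le _ _))// leq_add.
Qed.

Lemma deg_msupp p d m : (deg p <= d)%N -> m \in msupp p -> (mdeg m <= d)%N.
Proof. rewrite degE => pd /(@msize_mdeg_lt _ _ p m); lia. Qed.

End Degree.

Section Certificates.
Context (R : realType) (n c : nat) (q : 'I_c -> {mpoly R[n]}).
Implicit Types (J K : {set 'I_c}) (p u v : {mpoly R[n]}).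

Notation qp := (prod_constr q).
Notation K_ := (@mpolyC n R).

(* Unlike in [preordering], every square is of low degree, which makes pairing
   with pseudo-moments immediate. *)
Inductive cert (s : nat) : {mpoly R[n]} -> Prop :=
| cert0 : cert s 0
| cert_cons u J p : (deg u + half_deg (qp J) <= s)%N -> cert s p ->
    cert s (u ^+ 2 * qp J + p).

Lemma cert_term s u J : (deg u + half_deg (qp J) <= s)%N ->
  cert s (u ^+ 2 * qp J).
Proof. by move=> us; rewrite -[X in cert _ X]addr0; apply: cert_cons => //; apply: cert0. Qed.

Lemma certD s p p' : cert s p -> cert s p' -> cert s (p + p').
Proof.
move=> + Hp'; elim => [|u J p1 us _ IH]; first by rewrite add0r.
by rewrite -addrA; apply: cert_cons.
Qed.

Lemma cert_mono s t p : (s <= t)%N -> cert s p -> cert t p.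
Proof.
move=> st; elim => [|u J p1 us _ IH]; first exact: cert0.
by apply: cert_cons => //; apply: leq_trans st.
Qed.

Lemma cert_sum (I : Type) (r : seq I) (P : pred I) (F : I -> {mpoly R[n]}) s :
  (forall i, P i -> cert s (F i)) -> cert s (\sum_(i <- r | P i) F i).
Proof.
move=> Fs; apply: (big_ind (cert s)) => //; first exact: cert0.
exact: certD.
Qed.

Lemma prod_constr0 : qp finset.set0 = 1.
Proof. by rewrite /prod_constr big_set0. Qed.

Lemma half_deg1 : half_deg (1 : {mpoly R[n]}) = 0%N.
Proof. by rewrite /half_deg deg1. Qed.

Lemma cert_sq s u : (deg u <= s)%N -> cert s (u ^+ 2).
Proof.
move=> us; rewrite -[X in cert _ X]mulr1 -prod_constr0; apply: cert_term.
by rewrite prod_constr0 half_deg1 addn0.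
Qed.

(** Factors common to both products pair up into a square, which leaves the symmetric difference. So
    products of constraints never need exponents above one. *)
Lemma prod_constrD J K :
  qp J * qp K = qp (J :&: K) ^+ 2 * qp ((J :\: K) :|: (K :\: J)).
Proof.
have E A B : qp A = qp (A :&: B) * qp (A :\: B) by rewrite /prod_constr -finset.big_setID.
have -> : qp ((J :\: K) :|: (K :\: J)) = qp (J :\: K) * qp (K :\: J).
  by rewrite (E _ J); congr (qp _ * qp _); apply/finset.setP => i; rewrite !finset.inE;
    case: (i \in J); case: (i \in K).
by rewrite (E J K) (E K J) (finset.setIC K J); ring.
Qed.

(** The degree is twice that of the common part plus that of the symmetric difference, and rounding
    up each half separately only helps. Degrees add for nonzero products only: a zero factor would
    hide the degree of the others. *)
Lemma half_deg_mul J K : qp J * qp K != 0 ->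
  (deg (qp (J :&: K)) + half_deg (qp ((J :\: K) :|: (K :\: J)))
     <= half_deg (qp J) + half_deg (qp K))%N.
Proof.
move=> JK0; have := degM JK0.
move: JK0; rewrite prod_constrD => JK0; rewrite (degM JK0).
have I0 : qp (J :&: K) ^+ 2 != 0 by move: JK0; rewrite mulf_eq0 negb_or => /andP[].
by rewrite expr2 in I0 *; rewrite (degM I0) => /uphalf_leq_add.
Qed.

Lemma certM s t p p' : cert s p -> cert t p' -> cert (s + t) (p * p').
Proof.
elim => [|u J p1 us _ IH] Hp'; first by rewrite mul0r; apply: cert0.
rewrite mulrDl; apply: certD; last exact: IH.
elim: Hp' => [|v K p2 vt _ IH']; first by rewrite mulr0; apply: cert0.
rewrite mulrDr; apply: certD => //.
have -> : u ^+ 2 * qp J * (v ^+ 2 * qp K) = u ^+ 2 * v ^+ 2 * (qp J * qp K) by ring.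
have [->|JK0] := eqVneq (qp J * qp K) 0; first by rewrite mulr0; apply: cert0.
have le := half_deg_mul JK0.
rewrite prod_constrD mulrA -!exprMn; apply: cert_term.
apply: leq_trans (leq_add (leq_trans (degM_le _ _) (leq_add (degM_le _ _) (leqnn _))) (leqnn _)) _.
by rewrite -addnA (leq_trans (leq_add (leqnn _) le)) // addnACA leq_add.
Qed.

Lemma certC s a : 0 <= a -> cert s (K_ a).
Proof.
move=> a0; rewrite -(sqr_sqrtr a0) rmorphXn; apply: cert_sq.
by rewrite degC.
Qed.

Lemma certCM s a p : 0 <= a -> cert s p -> cert s (K_ a * p).
Proof. by move=> a0 ps; rewrite -[s]add0n; apply: certM => //; apply: certC. Qed.

Lemma cert_constr j : cert (half_deg (q j)) (q j).
Proof.
have E : qp (finset.set1 j) = q j by rewrite /prod_constr big_set1.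
have := @cert_term (half_deg (q j)) 1 (finset.set1 j).
by rewrite E expr1n mul1r; apply; rewrite deg1.
Qed.

Lemma cert_prod (I : Type) (r : seq I) (F : I -> {mpoly R[n]}) s :
  (forall i, cert s (F i)) -> cert (size r * s) (\prod_(i <- r) F i).
Proof.
move=> Fs; elim: r => [|i r IH]; first by rewrite big_nil -mpolyC1; apply: certC.
by rewrite big_cons mulSn; apply: certM.
Qed.

(** The defect in (p + p')^2 <= 2 p^2 + 2 p'^2 is the square of p - p'. *)
Lemma cert_sqD s p p' P P' : (deg p <= s)%N -> (deg p' <= s)%N ->
  cert s (P - p ^+ 2) -> cert s (P' - p' ^+ 2) ->
  cert s (2 * P + 2 * P' - (p + p') ^+ 2).
Proof.
move=> dp dp' H H'.
have -> : 2 * P + 2 * P' - (p + p') ^+ 2 =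
    K_ 2 * (P - p ^+ 2) + K_ 2 * (P' - p' ^+ 2) + (p - p') ^+ 2.
  by rewrite rmorph_nat; ring.
apply: certD; first by apply: certD; apply: certCM.
by apply: cert_sq; apply: deg_add; rewrite ?degN.
Qed.

(** Completing the square gives (u + b)^2 / (2 b); a linear term is thus traded for a constant and a
    square. *)
Lemma cert_amgm s u b : 0 < b -> (deg u <= s)%N ->
  cert s (K_ (b / 2) + u + K_ ((2 * b)^-1) * u ^+ 2).
Proof.
move=> b0 us.
have -> : K_ (b / 2) + u + K_ ((2 * b)^-1) * u ^+ 2 = K_ ((2 * b)^-1) * (u + K_ b) ^+ 2.
  have -> : K_ (b / 2) = K_ ((2 * b)^-1) * K_ b ^+ 2.
    by rewrite -rmorphXn -rmorphM; congr mpolyC; field; rewrite gt_eqF.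
  have {1}-> : u = 2 * (K_ ((2 * b)^-1) * K_ b) * u.
    rewrite -rmorphM -(rmorph_nat K_) -rmorphM.
    have -> : 2 * ((2 * b)^-1 * b) = 1 by field; rewrite gt_eqF.
    by rewrite rmorph1 mul1r.
  ring.
apply: certCM; first by rewrite invr_ge0 mulr_ge0 // ltW.
by apply: cert_sq; apply: deg_add; rewrite ?degC.
Qed.

Lemma cert_ge0 s p x : (forall j, 0 <= peval (q j) x) -> cert s p -> 0 <= peval p x.
Proof.
move=> qx; rewrite /peval; elim => [|u J p1 _ _ IH]; first by rewrite meval0.
rewrite mevalD addr_ge0 // mevalM mulr_ge0 //; first by rewrite expr2 mevalM -expr2 sqr_ge0.
rewrite /prod_constr rmorph_prod; apply: prodr_ge0 => j _; exact: qx.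
Qed.

Lemma sosD s u p : (deg u <= s)%N -> sos s p -> sos s (u ^+ 2 + p).
Proof.
move=> us [ps [h Ep]]; split; last by exists (u :: h); rewrite big_cons -Ep.
by apply: deg_add => //; apply: degX_le.
Qed.

Lemma cert_preordering s p : cert s p -> preordering q s p.
Proof.
elim => [|u J p1 us _ [sigma ssigma ->]].
  exists (fun=> 0); last by rewrite big1 // => J _; rewrite mul0r.
  by move=> J _; split; [rewrite deg0 | exists [::]; rewrite big_nil].
have Js : (half_deg (qp J) <= s)%N by apply: leq_trans us; rewrite leq_addl.
exists (fun K => if K == J then u ^+ 2 + sigma J else sigma K).
  move=> K Ks; case: eqP => [E|_]; last exact: ssigma.
  by rewrite E in Ks *; apply: sosD (ssigma _ Js); move: us; rewrite leq_subRL // addnC.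
rewrite !(bigD1 J Js) /= eqxx mulrDl -addrA; congr (_ + (_ + _)).
by apply: eq_bigr => K /andP[_ /negbTE->].
Qed.

End Certificates.

(** * Lipschitz certificates on the box *)

Lemma mpoly_ring_ind (R : realType) (n : nat) (P : {mpoly R[n]} -> Prop) :
  (forall a, P (mpolyC n a)) -> (forall i, P (mpolyX R (mnm1 i))) ->
  (forall p q, P p -> P q -> P (p + q)) -> (forall p q, P p -> P q -> P (p * q)) ->
  forall p, P p.
Proof.
move=> PC PX PD PM p; rewrite (mpolyE p); apply: big_ind => //.
  by rewrite -mpolyC0.
move=> m _; rewrite -mul_mpolyC; apply: (PM) => //.
rewrite mpolyXE_id; apply: big_ind => //; first by rewrite -mpolyC1.
move=> i _; elim: (m i) => [|k IH]; first by rewrite expr0 -mpolyC1.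
by rewrite exprS; apply: PM.
Qed.

Section BoxLipschitz.
Context (R : realType) (n c : nat) (q : 'I_c -> {mpoly R[n]}) (rad : R).
Implicit Types (p : {mpoly R[n]}) (a : 'rV[R]_n).

Notation K_ := (@mpolyC n R).
Notation X_ i := (mpolyX R (mnm1 i)).

Definition box a : Prop := forall i, `|a ord0 i| <= rad.

Definition sqdist a : {mpoly R[n]} := \sum_i (X_ i - K_ (a ord0 i)) ^+ 2.

(** A Lipschitz bound for a product needs bounds on the factors too, both as a certificate in x and
    at the point a. The constants and the order are chosen before a, as one order must serve all
    nodes. *)
Definition box_lipschitz p : Prop := exists M L s,
  [/\ 0 <= M, 0 <= L, cert q s (K_ M - p ^+ 2) &
   forall a, box a -> peval p a ^+ 2 <= M /\
     cert q s (K_ L * sqdist a - (p - K_ (peval p a)) ^+ 2)].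

Hypothesis cert_box : forall i, cert q 1 (K_ (rad ^+ 2) - X_ i ^+ 2).

Lemma deg_Xi (i : 'I_n) : deg (X_ i : {mpoly R[n]}) = 1%N.
Proof. by rewrite degX mdeg1. Qed.

Lemma cert_sqdist a s : (0 < s)%N -> cert q s (sqdist a).
Proof.
move=> s0; apply: cert_sum => i _; apply: cert_sq.
by apply: deg_add; rewrite ?degN ?degC ?deg_Xi.
Qed.

Lemma box_lipschitzC b : box_lipschitz (K_ b).
Proof.
exists (b ^+ 2), 0, 0%N; split=> //; first exact: sqr_ge0.
  by rewrite rmorphXn subrr; apply: cert0.
move=> a _; rewrite /peval mevalC rmorph0 mul0r !subrr expr0n /= subrr.
by split => //; apply: cert0.
Qed.

Lemma box_lipschitzX i : box_lipschitz (X_ i).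
Proof.
exists (rad ^+ 2), 1, 1%N; split=> //; first exact: sqr_ge0.
move=> a aB; rewrite /peval mevalXU; split.
  rewrite -[X in X <= _]real_normK ?num_real //; rewrite ler_sqr ?nnegrE ?normr_ge0 //.
  exact: le_trans (aB i).
rewrite rmorph1 mul1r /sqdist (bigD1 i) //= addrAC subrr add0r.
apply: cert_sum => j _; apply: cert_sq.
by apply: deg_add; rewrite ?degN ?degC ?deg_Xi.
Qed.

Lemma box_lipschitzD p p' :
  box_lipschitz p -> box_lipschitz p' -> box_lipschitz (p + p').
Proof.
move=> [M [L [s [M0 L0 Hb Hl]]]] [M' [L' [s' [M0' L0' Hb' Hl']]]].
pose t := (s + s' + deg p + deg p')%N.
have st : (s <= t)%N by rewrite /t; lia.
have st' : (s' <= t)%N by rewrite /t; lia.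
have pt : (deg p <= t)%N by rewrite /t; lia.
have pt' : (deg p' <= t)%N by rewrite /t; lia.
exists (2 * M + 2 * M'), (2 * L + 2 * L'), t; split.
- by rewrite addr_ge0 // mulr_ge0.
- by rewrite addr_ge0 // mulr_ge0.
- rewrite rmorphD !rmorphM !rmorph_nat; apply: cert_sqD => //.
    exact: cert_mono Hb.
  exact: cert_mono Hb'.
move=> a aB; have [pa Ha] := Hl a aB; have [pa' Ha'] := Hl' a aB.
rewrite /peval mevalD -!/(peval _ _); split.
  have := sqr_ge0 (peval p a - peval p' a); nra.
have -> : K_ (2 * L + 2 * L') * sqdist a - (p + p' - K_ (peval p a + peval p' a)) ^+ 2 =
    2 * (K_ L * sqdist a) + 2 * (K_ L' * sqdist a)
     - ((p - K_ (peval p a)) + (p' - K_ (peval p' a))) ^+ 2.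
  by rewrite !rmorphD !rmorphM !rmorph_nat; ring.
apply: cert_sqD; [| |exact: cert_mono Ha|exact: cert_mono Ha'].
- by apply: deg_add; rewrite ?degN ?degC.
- by apply: deg_add; rewrite ?degN ?degC.
Qed.

(** Leibniz splitting: with u = p - p(a) and u' = p' - p'(a), the increment of the product is p u' +
    p'(a) u. The first term uses the certified bound on p, the second the bound on p'(a). *)
Lemma box_lipschitzM p p' :
  box_lipschitz p -> box_lipschitz p' -> box_lipschitz (p * p').
Proof.
move=> [M [L [s [M0 L0 Hb Hl]]]] [M' [L' [s' [M0' L0' Hb' Hl']]]].
pose d := (deg p + deg p')%N; pose t := (s + s' + d)%N.
have dt : (d <= t)%N by rewrite /t; lia.
have std : (s + d <= t)%N by rewrite /t; lia.
have std' : (s' + d <= t)%N by rewrite /t; lia.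
have pd : (deg p <= d)%N by rewrite /d; lia.
have pd' : (deg p' <= d)%N by rewrite /d; lia.
have sqM u v r : cert q r u -> (r + d <= t)%N -> (deg v <= d)%N -> cert q t (u * v ^+ 2).
  by move=> ur rt vd; apply: (cert_mono rt); apply: certM => //; apply: cert_sq.
exists (M * M'), (2 * (M * L') + 2 * (M' * L)), t; split.
- exact: mulr_ge0.
- by rewrite addr_ge0 // !mulr_ge0.
- have -> : K_ (M * M') - (p * p') ^+ 2 =
      K_ M * (K_ M' - p' ^+ 2) + (K_ M - p ^+ 2) * p' ^+ 2.
    by rewrite rmorphM; ring.
  apply: certD; last exact: sqM Hb _ pd'.
  by apply: certCM => //; apply: cert_mono Hb'; rewrite /t; lia.
move=> a aB; have [pa Ha] := Hl a aB; have [pa' Ha'] := Hl' a aB.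
rewrite /peval mevalM -!/(peval _ _); split.
  by rewrite exprMn ler_pM // sqr_ge0.
set u := p - K_ (peval p a) in Ha *; set u' := p' - K_ (peval p' a) in Ha' *.
have du : (deg u <= d)%N by apply: deg_add; rewrite ?degN ?degC.
have du' : (deg u' <= d)%N by apply: deg_add; rewrite ?degN ?degC.
have -> : K_ (2 * (M * L') + 2 * (M' * L)) * sqdist a
    - (p * p' - K_ (peval p a * peval p' a)) ^+ 2 =
    2 * (K_ M * (K_ L' * sqdist a)) + 2 * (K_ M' * (K_ L * sqdist a))
     - (p * u' + K_ (peval p' a) * u) ^+ 2.
  by rewrite !rmorphD !rmorphM !rmorph_nat /u /u'; ring.
apply: cert_sqD.
- apply: leq_trans (degM_le _ _) _; apply: leq_trans dt.
  by rewrite leq_add // /u'; apply: deg_add; rewrite ?degN ?degC.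
- by apply: leq_trans (degM_le _ _) _; rewrite degC add0n (leq_trans du).
- have -> : K_ M * (K_ L' * sqdist a) - (p * u') ^+ 2 =
     K_ M * (K_ L' * sqdist a - u' ^+ 2) + (K_ M - p ^+ 2) * u' ^+ 2 by ring.
  apply: certD; last exact: sqM Hb _ du'.
  by apply: certCM => //; apply: cert_mono Ha'; rewrite /t; lia.
- have -> : K_ M' * (K_ L * sqdist a) - (K_ (peval p' a) * u) ^+ 2 =
     K_ M' * (K_ L * sqdist a - u ^+ 2) + K_ (M' - peval p' a ^+ 2) * u ^+ 2.
    by rewrite rmorphB rmorphXn; ring.
  apply: certD; first by apply: certCM => //; apply: cert_mono Ha; rewrite /t; lia.
  by apply: certCM; [rewrite subr_ge0 | apply: cert_sq; apply: leq_trans dt].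
Qed.

Lemma box_lipschitzT p : box_lipschitz p.
Proof.
move: p; apply: mpoly_ring_ind; [exact: box_lipschitzC | exact: box_lipschitzX | |].
- exact: box_lipschitzD.
- exact: box_lipschitzM.
Qed.

End BoxLipschitz.

(** * The Jackson kernel *)

Definition dist (j k : nat) : nat := (j - k + (k - j))%N.

Section Trigonometry.
Context (R : realType).
Implicit Types (x h : R).

Lemma sin_le x : 0 <= x -> sin x <= x.
Proof.
move=> x0; have dsin y : y \in `]0, x[ -> is_derive y 1 (@sin R) (cos y).
  by move=> _; apply: is_derive_sin.
have csin : {within `[0, x], continuous (@sin R)}.
  by apply: continuous_subspaceT => y; apply: continuous_sin.
have [y _] := MVT_segment x0 dsin csin.
rewrite sin0 !subr0 => ->.
by rewrite ler_piMl // cos_le1.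
Qed.

(** By the half-angle formula it suffices that |sin (x/2)| <= x/2; the lower bound follows from the
    sign of sin up to pi and from sin >= -1 beyond. *)
Lemma cos_ge x : 0 <= x -> 1 - x ^+ 2 / 2 <= cos x.
Proof.
move=> x0; have s1 : sin (x / 2) <= x / 2 by rewrite sin_le // divr_ge0.
have s2 : - (x / 2) <= sin (x / 2).
  have [xpi|pix] := leP (x / 2) pi.
    by rewrite (@le_trans _ _ 0) ?oppr_le0 ?divr_ge0 ?sin_ge0_pi // divr_ge0.
  by have := sin_geN1 (x / 2); have := pi_ge2 R; lra.
have -> : cos x = 1 - 2 * sin (x / 2) ^+ 2.
  have {1}-> : x = (x / 2) *+ 2 by rewrite -mulr_natr; field.
  by rewrite cos_mulr2n cos2sin2 -mulr_natr; ring.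
nra.
Qed.

Lemma cos_dist x j k : cos ((dist j k)%:R * x) =
  cos (j%:R * x) * cos (k%:R * x) + sin (j%:R * x) * sin (k%:R * x).
Proof.
wlog kj : j k / (k <= j)%N => [th|].
  have [|/ltnW jk] := leqP k j; first exact: th.
  by rewrite /dist addnC -/(dist k j) th // mulrC [X in _ + X]mulrC.
rewrite -cosB /dist (eqP kj) addn0 natrB //; congr cos; ring.
Qed.

(** Multiplied by 2 sin x with x = d pi / M, the sum telescopes, and its two end terms cancel by
    periodicity. The range of d keeps sin x positive. *)
Lemma sum_cos_period (M d : nat) : (0 < d < M)%N ->
  \sum_(l < M) cos (d%:R * (2 * pi * l%:R / M%:R)) = 0 :> R.
Proof.
move=> /andP[d0 dM]; have M0 : (M%:R : R) != 0 by rewrite pnatr_eq0; lia.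
pose x : R := d%:R * pi / M%:R.
have sx : 0 < sin x.
  apply: sin_gt0_pi; rewrite /x; apply/andP; split.
    by rewrite divr_gt0 ?mulr_gt0 ?pi_gt0 ?ltr0n //; lia.
  rewrite ltr_pdivrMr ?ltr0n; last by lia.
  by rewrite mulrC ltr_pM2l ?pi_gt0 // ltr_nat.
have tel m : 2 * sin x * \sum_(l < m) cos (d%:R * (2 * pi * l%:R / M%:R)) =
    sin ((2 * m%:R - 1) * x) + sin x.
  elim: m => [|m IH].
    by rewrite big_ord0 mulr0 mulr0 sub0r mulN1r sinN addNr.
  rewrite big_ord_recr /= mulrDr {}IH.
  have -> : d%:R * (2 * pi * m%:R / M%:R) = 2 * m%:R * x by rewrite /x; field.
  have -> : (2 * m.+1%:R - 1) * x = 2 * m%:R * x + x by rewrite -natr1; ring.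
  have -> : (2 * m%:R - 1) * x = 2 * m%:R * x - x by ring.
  rewrite sinB sinD; ring.
have := tel M.
have -> : (2 * M%:R - 1) * x = - x + (pi *+ 2) *+ d.
  by rewrite -mulrnA -[pi *+ _]mulr_natr natrM /x; field.
rewrite (periodicn (@sinD2pi R)) sinN addNr => /eqP; rewrite !mulf_eq0 pnatr_eq0 /=.
by rewrite (gt_eqF sx) /= => /eqP.
Qed.

(** Product-to-sum. The bound [d + e < M] excludes aliasing, and e > 0 keeps the sum frequency away
    from 0. *)
Lemma sum_cos_prod (M d e : nat) : (0 < e)%N -> (d + e < M)%N ->
  \sum_(l < M) cos (e%:R * (2 * pi * l%:R / M%:R)) * cos (d%:R * (2 * pi * l%:R / M%:R))
   = (M%:R / 2) * (d == e)%:R :> R.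
Proof.
move=> e0 deM.
transitivity (2^-1 * (\sum_(l < M) cos ((dist d e)%:R * (2 * pi * l%:R / M%:R)) +
   \sum_(l < M) cos ((d + e)%:R * (2 * pi * l%:R / M%:R))) : R).
  rewrite -big_split mulr_sumr; apply: eq_bigr => l _.
  by rewrite /= cos_dist natrD [(_ + _) * (2 * _ * _ / _)]mulrDl cosD; field.
rewrite [X in _ * (_ + X)]sum_cos_period; last by lia.
rewrite addr0; have [->|de] := eqVneq d e.
  rewrite (eq_bigr (fun=> 1)) ?sumr_const ?card_ord; last first.
    by move=> l _; rewrite /dist subnn mul0r cos0.
  by rewrite mulr1 mulrC.
by rewrite sum_cos_period ?mulr0 // /dist; lia.
Qed.

End Trigonometry.

Section Chebyshev.
Context (A : comNzRingType) (z : A).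

(* The pair (T_k, U_(k-1)), i.e. (cos k t, sin k t / sin t) at z = cos t. *)
Fixpoint cheb k : A * A :=
  if k is j.+1 then
    (z * (cheb j).1 - (1 - z ^+ 2) * (cheb j).2, (cheb j).1 + z * (cheb j).2)
  else (1, 0).

(** The polynomial form of cos (j - k) t = cos j t cos k t + sin j t sin k t, where 1 - z^2 stands
    for the square of sin t. It is proved by induction on the common shift of j and k. *)
Lemma cheb_dist j k :
  (cheb j).1 * (cheb k).1 + (1 - z ^+ 2) * ((cheb j).2 * (cheb k).2) = (cheb (dist j k)).1.
Proof.
wlog kj : j k / (k <= j)%N => [th|].
  have [|/ltnW jk] := leqP k j; first exact: th.
  by rewrite /dist addnC -/(dist k j) -th // mulrC [in X in _ + X]mulrC; ring.
have -> : dist j k = (j - k)%N by rewrite /dist; lia.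
rewrite -{1 2}(subnK kj); move: (j - k)%N => d; elim: k {kj} => [|k IH] /=.
  by rewrite addn0; ring.
by rewrite -IH addnS /=; ring.
Qed.

End Chebyshev.

Section JacksonWeights.
Context (R : realType) (N : nat).
Hypothesis N0 : (0 < N)%N.

Definition jackson_step : R := pi / N.+1%:R.

(** For 1 <= j <= N this is the top eigenvector of the path adjacency matrix, with eigenvalue 2 cos
    h. It maximises the lag-one correlation relative to the sum of squares, hence the small second
    moment of the kernel. *)
Definition jackson_weight (j : nat) : R := sin (j%:R * jackson_step).

(** The autocorrelation of the weights at lag e. For e > 0 both k = j - e and k = j + e count, which
    explains the factors 2 below. *)
Definition jackson_corr (e : nat) : R :=
  \sum_(j < N.+2) \sum_(k < N.+2)
    jackson_weight j * jackson_weight k * (dist j k == e)%:R.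

Notation h := jackson_step.
Notation w := jackson_weight.
Notation S := (jackson_corr 0).

Lemma sum_dist (F : nat -> R) (m j e : nat) : (0 < e)%N -> (j < m)%N ->
  \sum_(k < m) F k * (dist j k == e)%:R =
  F (j - e)%N * (e <= j)%N%:R + F (j + e)%N * (j + e < m)%N%:R.
Proof.
move=> e0 jm.
have pick a b : \sum_(k < m) F k * ((k == a :> nat) && b)%:R = F a * ((a < m)%N && b)%:R.
  have [am|ma] := ltnP a m.
    rewrite (bigD1 (Ordinal am)) //= eqxx big1 ?addr0 // => k ka.
    by rewrite -val_eqE /= in ka; rewrite (negbTE ka) mulr0.
  rewrite mulr0 big1 // => k _.
  by rewrite (_ : (k == a :> nat) = false) ?mulr0 //; have := ltn_ord k; lia.
rewrite -[(j + e < m)%N]andbT -pick.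
have -> : (e <= j)%N = ((j - e < m)%N && (e <= j)%N) by lia.
rewrite -pick -big_split; apply: eq_bigr => k _ /=; rewrite -mulrDr -natrD; congr (_ * _%:R).
by rewrite /dist; lia.
Qed.

Lemma jackson_corr0 : S = \sum_(j < N.+2) w j ^+ 2.
Proof.
apply: eq_bigr => j _; rewrite (bigD1 j) //= big1 ?addr0.
  by rewrite /dist subnn mulr1 expr2.
by move=> k kj; rewrite (_ : dist j k == 0%N = false) ?mulr0 //;
  move: kj; rewrite -val_eqE /dist /=; lia.
Qed.

Lemma step_gt0 : 0 < h. Proof. by rewrite divr_gt0 ?pi_gt0 ?ltr0n. Qed.

Lemma weight_last : w N.+1 = 0.
Proof. by rewrite /w mulrC divfK ?sinpi // pnatr_eq0. Qed.

Lemma weight_ge0 j : (j <= N.+1)%N -> 0 <= w j.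
Proof.
move=> jN; apply: sin_ge0_pi; rewrite mulr_ge0 ?ler0n ?(ltW step_gt0) //=.
by rewrite /h mulrA ler_pdivrMr ?ltr0n // mulrC ler_pM2l ?pi_gt0 // ler_nat.
Qed.

Lemma jackson_corr0_gt0 : 0 < S.
Proof.
rewrite jackson_corr0 (bigD1 (inord 1)) //= inordK //.
apply: ltr_wpDr; first by apply: sumr_ge0 => i _; apply: sqr_ge0.
rewrite exprn_gt0 // /w mul1r; apply: sin_gt0_pi; rewrite step_gt0 /=.
by rewrite /h ltr_pdivrMr ?ltr0n // ltr_pMr ?pi_gt0 // ltr1n.
Qed.

(** From 2 w_j w_k <= w_j^2 + w_k^2, since an index has at most two neighbours at distance e. *)
Lemma jackson_corr_le e : (0 < e)%N -> jackson_corr e <= 2 * S.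
Proof.
move=> e0; pose D j k : R := (dist j k == e)%:R.
have cnt j : (j < N.+2)%N -> \sum_(k < N.+2) D j k <= 2.
  move=> jN; have /= := sum_dist (fun=> 1) e0 jN; rewrite /D.
  under eq_bigr do rewrite mul1r.
  move=> ->; rewrite !mul1r; by case: (_ <= _)%N; case: (_ < _)%N => /=; lra.
have le : 2 * jackson_corr e <= \sum_(j < N.+2) \sum_(k < N.+2) (w j ^+ 2 * D j k)
     + \sum_(j < N.+2) \sum_(k < N.+2) (w k ^+ 2 * D j k).
  rewrite -big_split mulr_sumr; apply: ler_sum => j _.
  rewrite -big_split mulr_sumr; apply: ler_sum => k _ /=; rewrite /D.
  by case: eqP => _ /=; have := sqr_ge0 (w j - w k); nra.
have half : \sum_(j < N.+2) \sum_(k < N.+2) (w j ^+ 2 * D j k) <= 2 * S.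
  rewrite jackson_corr0 mulr_sumr; apply: ler_sum => j _.
  by rewrite -mulr_sumr mulrC ler_wpM2r ?sqr_ge0 ?cnt.
suff : \sum_(j < N.+2) \sum_(k < N.+2) (w k ^+ 2 * D j k) <= 2 * S by lra.
rewrite exchange_big /=; apply: le_trans half; apply: ler_sum => j _.
by apply: ler_sum => k _; rewrite /D /dist addnC.
Qed.

(** The addition formulas give equality while both neighbours are in range. For e = 2 a neighbour
    may fall outside, at j = 1 or j = N; its sine is then nonpositive, so dropping it only increases
    the sum. *)
Lemma weight_neighbours e j : (0 < e <= 2)%N -> (0 < j < N.+1)%N ->
  2 * cos (e%:R * h) * w j <= \sum_(k < N.+2) w k * (dist j k == e)%:R.
Proof.
move=> /andP[e0 e2] /andP[j0 jN]; rewrite sum_dist //; last by lia.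
have -> : 2 * cos (e%:R * h) * w j = sin (j%:R * h - e%:R * h) + sin (j%:R * h + e%:R * h).
  by rewrite sinB sinD /w; ring.
apply: lerD.
  have [ej|je] := leqP e j; first by rewrite mulr1 /w natrB // mulrBl.
  have [-> ->] : j = 1%N /\ e = 2 by split; lia.
  rewrite mulr0 -mulrBl (_ : 1 - 2 = -1); last by lra.
  rewrite mulN1r sinN oppr_le0; have := @weight_ge0 1; rewrite /w mul1r; apply; lia.
have [ej|je] := ltnP (j + e) N.+2; first by rewrite mulr1 /w natrD mulrDl.
have [-> ->] : j = N /\ e = 2 by split; lia.
have -> : N%:R * h + 2 * h = h + pi.
  have E : N.+1%:R * h = pi by rewrite mulrC divfK // pnatr_eq0.
  by rewrite -E -natr1; ring.
rewrite sinDpi mulr0 oppr_le0; have := @weight_ge0 1; rewrite /w mul1r; apply; lia.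
Qed.

Lemma jackson_corr_ge e : (0 < e <= 2)%N -> 2 * cos (e%:R * h) * S <= jackson_corr e.
Proof.
move=> e02; rewrite jackson_corr0 mulr_sumr; apply: ler_sum => j _.
under [leRHS]eq_bigr do rewrite -mulrA; rewrite -mulr_sumr.
have wj : 0 <= w j by apply: weight_ge0; have := ltn_ord j; lia.
have [wj0|wj0] := eqVneq (w j) 0; first by rewrite wj0 expr0n /= mulr0 mul0r.
have j0 : (0 < j < N.+1)%N.
  apply/andP; split.
    by rewrite lt0n; apply: contra_neq wj0; rewrite /w => ->; rewrite mul0r sin0.
  have : j != N.+1 :> nat by apply: contra_neq wj0 => ->; exact: weight_last.
  by have := ltn_ord j; lia.
by have := ler_wpM2l wj (weight_neighbours e02 j0); rewrite expr2; lra.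
Qed.

End JacksonWeights.

Section UnivariateKernel.
Context (R : realType) (n c : nat) (q : 'I_c -> {mpoly R[n]}) (N : nat).
Hypothesis N0 : (0 < N)%N.
Implicit Types (z : {mpoly R[n]}).

Notation K_ := (@mpolyC n R).
Notation T_ z k := (cheb z k).1.
Notation V_ z k := (cheb z k).2.
Notation w := (@jackson_weight R N).
Notation S := (@jackson_corr R N 0).

(** Kernel frequencies are at most N + 1 and are tested against cosines of frequency at most 2, so N
    + 4 equispaced angles are enough to avoid aliasing. *)
Definition angle (l : nat) : R := 2 * pi * l%:R / N.+4%:R.

Definition node (l : nat) : R := cos (angle l).

(* With z = cos t, the average over +-t of |sum_j w_j exp(i j (t - angle l))|^2,
   normalised. *)
Definition jackson_kernel z (l : nat) : {mpoly R[n]} :=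
  K_ (N.+4%:R * S)^-1 *
   ((\sum_(j < N.+2) K_ (w j * cos (j%:R * angle l)) * T_ z j) ^+ 2 +
    (\sum_(j < N.+2) K_ (w j * sin (j%:R * angle l)) * T_ z j) ^+ 2 +
    (1 - z ^+ 2) * ((\sum_(j < N.+2) K_ (w j * cos (j%:R * angle l)) * V_ z j) ^+ 2 +
    (\sum_(j < N.+2) K_ (w j * sin (j%:R * angle l)) * V_ z j) ^+ 2)).

(** After expansion of the squares, [cos_dist] collects the factors in the angle and [cheb_dist]
    those in z. *)
Lemma jackson_kernelE z l : jackson_kernel z l = K_ (N.+4%:R * S)^-1 *
  \sum_(j < N.+2) \sum_(k < N.+2)
    K_ (w j * w k * cos ((dist j k)%:R * angle l)) * T_ z (dist j k).
Proof.
rewrite /jackson_kernel !expr2 !big_distrlr /=; congr (_ * _).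
rewrite -!big_split mulr_sumr -big_split /=; apply: eq_bigr => j _.
rewrite -!big_split mulr_sumr -big_split /=; apply: eq_bigr => k _.
by rewrite -cheb_dist cos_dist !rmorphM !rmorphD !rmorphM /=; ring.
Qed.

Lemma MS_neq0 : (N.+4%:R * S) != 0.
Proof. by rewrite mulf_neq0 ?pnatr_eq0 // gt_eqF // jackson_corr0_gt0. Qed.

Lemma sum_kernel z : \sum_(l < N.+4) jackson_kernel z l = 1.
Proof.
under eq_bigr do rewrite jackson_kernelE.
rewrite -mulr_sumr exchange_big /=.
have -> : \sum_(j < N.+2) \sum_(l < N.+4) \sum_(k < N.+2)
    K_ (w j * w k * cos ((dist j k)%:R * angle l)) * T_ z (dist j k) = K_ (N.+4%:R * S).
  rewrite /jackson_corr mulr_sumr rmorph_sum /=; apply: eq_bigr => j _.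
  rewrite exchange_big mulr_sumr rmorph_sum /=; apply: eq_bigr => k _.
  rewrite -mulr_suml -rmorph_sum /= -mulr_sumr.
  have [-> |d0] := eqVneq (dist j k) 0%N; last first.
    by rewrite sum_cos_period ?mulr0 ?rmorph0 ?mul0r // /dist;
      move: d0 (ltn_ord j) (ltn_ord k); rewrite /dist; lia.
  rewrite (eq_bigr (fun=> 1)) => [|l _]; last by rewrite mul0r cos0.
  by rewrite sumr_const card_ord mulr1 -[1 *+ _]/(N.+4%:R) !mulr1 mulrC.
by rewrite -rmorphM mulVf ?rmorph1 // MS_neq0.
Qed.

(** By discrete orthogonality only the lag e survives: averaging with the kernel multiplies T_e by a
    damping factor, which tends to 1 as N grows. *)
Lemma sum_cos_kernel z e : (0 < e <= 2)%N ->
  \sum_(l < N.+4) K_ (cos (e%:R * angle l)) * jackson_kernel z l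
    = K_ (jackson_corr R N e / (2 * S)) * T_ z e.
Proof.
move=> /andP[e0 e2]; under eq_bigr do rewrite jackson_kernelE mulrCA.
rewrite -mulr_sumr.
under eq_bigr do rewrite mulr_sumr.
rewrite exchange_big /=.
have -> : \sum_(j < N.+2) \sum_(l < N.+4) K_ (cos (e%:R * angle l)) * (\sum_(k < N.+2)
    K_ (w j * w k * cos ((dist j k)%:R * angle l)) * T_ z (dist j k))
   = K_ (N.+4%:R / 2 * jackson_corr R N e) * T_ z e.
  rewrite /jackson_corr mulr_sumr rmorph_sum mulr_suml /=; apply: eq_bigr => j _.
  under eq_bigr do rewrite mulr_sumr.
  rewrite exchange_big mulr_sumr rmorph_sum mulr_suml /=; apply: eq_bigr => k _.
  have dN : (dist j k + e < N.+4)%N.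
    by rewrite /dist; move: (ltn_ord j) (ltn_ord k); lia.
  under eq_bigr do rewrite mulrA -rmorphM mulrCA.
  rewrite -mulr_suml -rmorph_sum /= -mulr_sumr sum_cos_prod //.
  have [->|_] := eqVneq (dist j k) e; last by rewrite !mulr0 rmorph0 !mul0r.
  by congr (K_ _ * _); ring.
rewrite mulrA -rmorphM; congr (K_ _ * _).
have := MS_neq0; rewrite mulf_eq0 negb_or => /andP[M0 S0].
by move: (N.+4%:R : R) M0 => M M0; field; rewrite S0 M0.
Qed.

Lemma node_norm l : `|node l| <= 1. Proof. exact: cos_max. Qed.

Lemma step_sq_le : 2 * jackson_step R N ^+ 2 <= 32 / N%:R ^+ 2.
Proof.
have p4 : pi <= 4 :> R by have := @pihalf_lt2 R; lra.
have NR : (0 : R) < N%:R by rewrite ltr0n.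
rewrite (_ : 32 = 2 * 4 ^+ 2); last by ring.
rewrite -mulrA ler_pM2l // -expr_div_n ler_sqr ?nnegrE ?divr_ge0 ?pi_ge0 //.
rewrite ler_pM ?pi_ge0 ?invr_ge0 // lef_pV2 ?posrE ?ltr0n // ler_nat; exact: leqnSn.
Qed.

(** Only T_1 and T_2 occur in the second moment, so it is quadratic in z although the kernel has
    degree O(N). With damping factors l1, l2 <= 1, the nonconstant part of the remainder is a
    nonnegative combination of 1 - z^2 and z^2. *)
Lemma cert_kernel_moment z : (deg z <= 1)%N -> cert q 1 (1 - z ^+ 2) ->
  cert q 1 (K_ (32 / N%:R ^+ 2) - \sum_(l < N.+4) (K_ (node l) - z) ^+ 2 * jackson_kernel z l).
Proof.
move=> dz z1.
pose l1 := jackson_corr R N 1 / (2 * S); pose l2 := jackson_corr R N 2 / (2 * S).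
have S0 := jackson_corr0_gt0 R N0.
have S20 : 0 < 2 * S by rewrite mulr_gt0.
have le1 e : (0 < e)%N -> jackson_corr R N e / (2 * S) <= 1.
  by move=> e0; rewrite ler_pdivrMr // mul1r jackson_corr_le.
have ge1 e : (0 < e <= 2)%N ->
    1 - (e%:R * jackson_step R N) ^+ 2 / 2 <= jackson_corr R N e / (2 * S).
  move=> e0; rewrite ler_pdivlMr //.
  have := jackson_corr_ge R N0 e0.
  have h0 : 0 <= e%:R * jackson_step R N by rewrite mulr_ge0 // ltW // step_gt0.
  have := cos_ge h0; nra.
have E : \sum_(l < N.+4) (K_ (node l) - z) ^+ 2 * jackson_kernel z l =
   K_ (1 / 2) + K_ (1 / 2 * l2) * (2 * z ^+ 2 - 1) - 2 * K_ l1 * z ^+ 2 + z ^+ 2.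
  have := sum_kernel z; have := @sum_cos_kernel z 1 isT; have := @sum_cos_kernel z 2 isT.
  move: (jackson_kernel z) => ker H2 H1 H0.
  transitivity (\sum_(l < N.+4) (K_ (1 / 2) * ker l +
     K_ (1 / 2) * (K_ (cos (2%:R * angle l)) * ker l) +
      (- 2 * z) * (K_ (cos (1%:R * angle l)) * ker l) + z ^+ 2 * ker l)).
    apply: eq_bigr => l _; rewrite (mul1r (angle l)) -/(node l).
    have -> : K_ (cos (2 * angle l)) = 2 * K_ (node l) ^+ 2 - 1.
      by rewrite mulr_natl cos_mulr2n rmorphB rmorphMn rmorphXn rmorph1 mulr_natl.
    have h2 : K_ (1 / 2) * 2 = 1.
      by rewrite -(rmorph_nat K_ 2) -rmorphM divfK ?rmorph1 // pnatr_eq0.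
    have -> : (K_ (node l) - z) ^+ 2 =
        (K_ (1 / 2) * 2) * K_ (node l) ^+ 2 - 2 * K_ (node l) * z + z ^+ 2.
      by rewrite h2; ring.
    ring.
  rewrite !big_split /=. rewrite -!mulr_sumr. rewrite H0 H1 H2 /=.
  by rewrite -/l1 -/l2 rmorphM; ring.
have l1le : l1 <= 1 by apply: le1.
have l2le : l2 <= 1 by apply: le1.
have l1ge := ge1 1%N isT; have l2ge := ge1 2%N isT.
rewrite -/l1 -/l2 in l1ge l2ge.
have -> : K_ (32 / N%:R ^+ 2) - \sum_(l < N.+4) (K_ (node l) - z) ^+ 2 * jackson_kernel z l =
   K_ (32 / N%:R ^+ 2 - ((1 - l2) / 2 + 2 * (1 - l1))) + K_ (2 * (1 - l1)) * (1 - z ^+ 2)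
   + K_ (1 - l2) * z ^+ 2.
  rewrite E; move: (l1) (l2) (32 / _) => a b C.
  have -> : C - ((1 - b) / 2 + 2 * (1 - a)) = C - 1 / 2 + 1 / 2 * b - 2 + 2 * a by field.
  have -> : 1 - b = 1 - 2 * (1 / 2 * b) by field.
  move: (1 / 2 * b) (1 / 2) => b' d.
  by rewrite !(rmorphB, rmorphD, rmorphM, rmorph1, rmorph_nat); ring.
apply: certD; first apply: certD.
(* With h the Jackson step, both (1 - l2) / 2 and 2 (1 - l1) are at most h^2, and 2 h^2 <= 32 / N^2
   because pi <= 4. *)
- apply: certC; have := step_sq_le; nra.
- by apply: certCM => //; lra.
- by apply: certCM; [lra | apply: cert_sq].
Qed.

(** A crude bound: the factor 1 - z^2 costs two degrees per step, and cancellation is not tracked.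
    Linear growth in k suffices for the rate. *)
Lemma deg_cheb z k : (deg z <= 1)%N ->
  (deg (T_ z k) <= 2 * k)%N /\ (deg (V_ z k) <= 2 * k)%N.
Proof.
move=> dz; elim: k => [|k [IHT IHV]] /=; first by rewrite deg1 deg0.
have degM_add (u v : {mpoly R[n]}) a b e : (deg u <= a)%N -> (deg v <= b)%N -> (a + b <= e)%N ->
    (deg (u * v : {mpoly R[n]})%R <= e)%N.
  by move=> ua vb; apply: leq_trans; apply: (leq_trans (degM_le _ _)); apply: leq_add.
have dz2 : (deg (1 - z ^+ 2)%R <= 2)%N.
  by apply: deg_add; rewrite ?deg1 // degN (leq_trans (degX_le 2 dz)).
split; apply: deg_add; rewrite ?degN.
- by apply: degM_add dz IHT _; lia.
- by apply: degM_add dz2 IHV _; lia.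
- by apply: leq_trans IHT _; lia.
- by apply: degM_add dz IHV _; lia.
Qed.

Lemma cert_kernel z l : (deg z <= 1)%N -> cert q 1 (1 - z ^+ 2) ->
  cert q (2 * N + 3) (jackson_kernel z l).
Proof.
move=> dz z1.
have degS (a : nat -> R) (F : nat -> {mpoly R[n]}) :
    (forall k, deg (F k) <= 2 * k)%N ->
    (deg (\sum_(j < N.+2) K_ (a j) * F j)%R <= 2 * N + 2)%N.
  move=> dF; apply: deg_sum => j _.
  apply: leq_trans (degM_le _ _) _; rewrite degC add0n (leq_trans (dF j)) //.
  by have := ltn_ord j; lia.
have dT k : (deg (T_ z k) <= 2 * k)%N by case: (deg_cheb k dz).
have dV k : (deg (V_ z k) <= 2 * k)%N by case: (deg_cheb k dz).
have S0 := jackson_corr0_gt0 R N0.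
rewrite /jackson_kernel; apply: certCM; first by rewrite invr_ge0 mulr_ge0 // ltW.
pose wc j := w j * cos (j%:R * angle l); pose ws j := w j * sin (j%:R * angle l).
have -> : (2 * N + 3 = 1 + (2 * N + 2))%N by lia.
apply: certD.
  apply: (@cert_mono _ _ _ _ (2 * N + 2)%N); first by lia.
  by apply: certD; apply: cert_sq; [exact: degS wc _ dT | exact: degS ws _ dT].
by apply: certM => //; apply: certD; apply: cert_sq; [exact: degS wc _ dV | exact: degS ws _ dV].
Qed.

End UnivariateKernel.

(** * Averaging over the grid *)

Section TensorKernel.
Context (R : realType) (n c : nat) (q : 'I_c -> {mpoly R[n]}) (rad : R) (N : nat).
Hypothesis N0 : (0 < N)%N.
Hypothesis rad0 : 0 < rad.
Hypothesis cert_box : forall i, cert q 1 (mpolyC n (rad ^+ 2) - mpolyX R (mnm1 i) ^+ 2).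

Notation K_ := (@mpolyC n R).
Notation X_ i := (mpolyX R (mnm1 i)).
Notation index := {ffun 'I_n -> 'I_N.+4}.

Definition scaled_var (i : 'I_n) : {mpoly R[n]} := K_ rad^-1 * X_ i.

Definition grid (l : index) : 'rV[R]_n := \row_i (rad * node R N (l i)).

Definition tensor_kernel (l : index) : {mpoly R[n]} :=
  \prod_i jackson_kernel N (scaled_var i) (l i).

Lemma box_grid l : box rad (grid l).
Proof.
move=> i; rewrite mxE normrM (gtr0_norm rad0) ler_piMr ?node_norm //; exact: ltW.
Qed.

Lemma deg_scaled_var i : (deg (scaled_var i) <= 1)%N.
Proof. by apply: leq_trans (degM_le _ _) _; rewrite degC deg_Xi. Qed.

Lemma cert_scaled_var i : cert q 1 (1 - scaled_var i ^+ 2).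
Proof.
have -> : 1 - scaled_var i ^+ 2 = K_ (rad ^- 2) * (K_ (rad ^+ 2) - X_ i ^+ 2).
  rewrite mulrBr -rmorphM mulVf ?expf_neq0 ?gt_eqF // rmorph1 /scaled_var exprMn.
  by rewrite -rmorphXn exprVn.
by apply: certCM => //; rewrite invr_ge0 sqr_ge0.
Qed.

Lemma cert_tensor_kernel l : cert q (n * (2 * N + 3)) (tensor_kernel l).
Proof.
have -> : (n * (2 * N + 3) = size (index_enum 'I_n) * (2 * N + 3))%N.
  by rewrite -sum1_size sum1_card card_ord.
apply: cert_prod => i; apply: cert_kernel => //; first exact: deg_scaled_var.
exact: cert_scaled_var.
Qed.

Lemma sum_tensor_kernel : \sum_l tensor_kernel l = 1.
Proof.
rewrite -(bigA_distr_bigA (fun i (k : 'I_N.+4) => jackson_kernel N (scaled_var i) k)).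
by rewrite big1 // => i _; rewrite sum_kernel.
Qed.

Lemma sum_tensor_kernel_sq j :
  \sum_l (X_ j - K_ (grid l ord0 j)) ^+ 2 * tensor_kernel l =
  K_ (rad ^+ 2) * \sum_(k < N.+4)
    (K_ (node R N k) - scaled_var j) ^+ 2 * jackson_kernel N (scaled_var j) k.
Proof.
(* The squared deviation is inserted in the j-th factor only; every other factor sums to 1 once sum
   and product are exchanged. *)
pose F i (k : 'I_N.+4) := (if i == j then (X_ j - K_ (rad * node R N k)) ^+ 2 else 1)
  * jackson_kernel N (scaled_var i) k.
transitivity (\sum_(l : index) \prod_i F i (l i)).
  apply: eq_bigr => l _; rewrite /F big_split /= -/(tensor_kernel l); congr (_ * _).
  by rewrite -big_mkcond big_pred1_eq mxE.
rewrite -(bigA_distr_bigA F) (bigD1 j) //= [X in _ * X]big1 ?mulr1.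
  rewrite mulr_sumr; apply: eq_bigr => k _; rewrite /F eqxx mulrA; congr (_ * _).
  have -> : X_ j = K_ rad * scaled_var j.
    by rewrite /scaled_var mulrA -rmorphM mulfV ?gt_eqF // rmorph1 mul1r.
  by rewrite rmorphM rmorphXn; ring.
move=> i ij; rewrite /F (negbTE ij); under eq_bigr do rewrite mul1r.
exact: sum_kernel.
Qed.

Lemma cert_sqdist_mean :
  cert q 1 (K_ (n%:R * rad ^+ 2 * (32 / N%:R ^+ 2))
    - \sum_l sqdist (grid l) * tensor_kernel l).
Proof.
have -> : \sum_l sqdist (grid l) * tensor_kernel l = \sum_j K_ (rad ^+ 2) *
    \sum_(k < N.+4) (K_ (node R N k) - scaled_var j) ^+ 2 * jackson_kernel N (scaled_var j) k.
  under [RHS]eq_bigr do rewrite -sum_tensor_kernel_sq.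
  by rewrite exchange_big; apply: eq_bigr => l _; rewrite /sqdist mulr_suml.
have -> : K_ (n%:R * rad ^+ 2 * (32 / N%:R ^+ 2)) =
    \sum_(j < n) K_ (rad ^+ 2) * K_ (32 / N%:R ^+ 2).
  by rewrite sumr_const card_ord -mulrA mulr_natl rmorphMn rmorphM.
rewrite -sumrB; apply: cert_sum => j _; rewrite -mulrBr; apply: certCM; first exact: sqr_ge0.
apply: cert_kernel_moment => //; first exact: deg_scaled_var.
exact: cert_scaled_var.
Qed.

(** As the kernels sum to 1, F is the average of the node certificates minus A times the mean
    squared distance, which [cert_sqdist_mean] bounds by a constant at order 1, whatever N is. *)
Lemma cert_average s (F : {mpoly R[n]}) A : 0 <= A ->
  (forall a, box rad a -> cert q s (F + K_ A * sqdist a)) ->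
  cert q (n * (2 * N + 3) + s + 1) (F + K_ (A * (n%:R * rad ^+ 2 * (32 / N%:R ^+ 2)))).
Proof.
move=> A0 H.
have -> : F + K_ (A * (n%:R * rad ^+ 2 * (32 / N%:R ^+ 2))) =
   \sum_l tensor_kernel l * (F + K_ A * sqdist (grid l)) +
   K_ A * (K_ (n%:R * rad ^+ 2 * (32 / N%:R ^+ 2)) - \sum_l sqdist (grid l) * tensor_kernel l).
  under eq_bigr do rewrite mulrDr.
  rewrite big_split /= -mulr_suml sum_tensor_kernel mul1r rmorphM mulrBr.
  rewrite -addrA; congr (_ + _); rewrite mulr_sumr addrCA -[LHS]addr0; congr (_ + _).
  apply/esym/eqP; rewrite subr_eq0; apply/eqP; apply: eq_bigr => l _; ring.
apply: certD.
  apply: (@cert_mono _ _ _ _ (n * (2 * N + 3) + s)); first by rewrite leq_addr.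
  apply: cert_sum => l _; apply: certM; first exact: cert_tensor_kernel.
  exact/H/box_grid.
apply: (@cert_mono _ _ _ _ 1); first by rewrite leq_addl.
by apply: certCM => //; apply: cert_sqdist_mean.
Qed.

End TensorKernel.

(** * Certificates for the constraints of X and the error O(1/sqrt N) *)

Section MainCertificate.
Context (R : realType) (n m : nat) (g : 'I_m -> {mpoly R[n]}) (rad : R).

Notation K_ := (@mpolyC n R).
Notation X_ i := (mpolyX R (mnm1 i)).
Notation q := (constr rad g).

Lemma half_deg_ball_poly : (half_deg (ball_poly n rad) <= 1)%N.
Proof.
suff : (deg (ball_poly n rad) <= 2)%N by rewrite /half_deg; case: deg => [|[|[|]]].
rewrite /ball_poly; apply: deg_add; rewrite ?degC // degN; apply: deg_sum => i _.
by rewrite (leq_trans (degX_le 2 (leqnn _))) // deg_Xi.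
Qed.

(** The redundant ball constraint provides the box: adding the squares of the other variables to q_0
    leaves one variable. *)
Lemma cert_box i : cert q 1 (K_ (rad ^+ 2) - X_ i ^+ 2).
Proof.
have -> : K_ (rad ^+ 2) - X_ i ^+ 2 = q ord0 + \sum_(j | j != i) X_ j ^+ 2.
  rewrite /constr unlift_none /ball_poly (bigD1 i) //=.
  by rewrite opprD addrA subrK.
apply: certD.
  apply: (cert_mono _ (cert_constr q ord0)).
  by rewrite /constr unlift_none half_deg_ball_poly.
by apply: cert_sum => j _; apply: cert_sq; rewrite deg_Xi.
Qed.

Lemma cert_neg_constr i : cert q (half_deg (g i)) (- g i).
Proof.
have := cert_constr q (lift ord0 i).
by rewrite /constr liftK /half_deg degN.
Qed.

Lemma constr_ge0 x : feasible g `<=` [set x | enorm x <= rad] -> 0 <= rad ->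
  feasible g x -> forall j, 0 <= peval (q j) x.
Proof.
move=> Xball r0 Xx j; rewrite /constr; case: unliftP => [i _|_].
  by rewrite /peval mevalN oppr_ge0; apply: Xx.
have := Xball _ Xx; rewrite /= /enorm /norm2 /peval /ball_poly => le.
rewrite mevalB mevalC subr_ge0 raddf_sum /=.
have -> : \sum_(i < n) meval (x ord0) (X_ i ^+ 2) = \sum_i x ord0 i ^+ 2.
  by apply: eq_bigr => i _; rewrite rmorphXn /= mevalXU.
have s0 : 0 <= \sum_i x ord0 i ^+ 2 by apply: sumr_ge0 => i _; apply: sqr_ge0.
by rewrite -(sqr_sqrtr s0) ler_sqr ?nnegrE ?sqrtr_ge0.
Qed.

Lemma peval_sqdist (a x : 'rV[R]_n) : peval (sqdist a) x = \sum_i (x ord0 i - a ord0 i) ^+ 2.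
Proof.
rewrite /peval raddf_sum; apply: eq_bigr => i _.
by rewrite /= rmorphXn /= mevalB mevalXU mevalC.
Qed.

(* Half of the error budget [d] pays for [f - f(a)], the other half for
   [f(a) - fmin], which the growth condition bounds by the violation at [a]. *)
Lemma cert_near_point (gr Lf fm d e : R) (f : {mpoly R[n]}) (L : 'I_m -> R)
    (s : nat) (a : 'rV[R]_n) :
  0 < d -> 0 < e -> 0 <= gr -> 0 <= Lf -> (forall i, 0 <= L i) ->
  (deg f <= s)%N -> (forall i, (deg (g i) <= s)%N) -> (0 < s)%N ->
  cert q s (K_ Lf * sqdist a - (f - K_ (peval f a)) ^+ 2) ->
  (forall i, cert q s (K_ (L i) * sqdist a - (g i - K_ (peval (g i) a)) ^+ 2)) ->
  (exists x, [/\ forall j, 0 <= peval (q j) x, fm <= peval f x &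
     \sum_i (x ord0 i - a ord0 i) ^+ 2 <= gr * \sum_i Num.max (peval (g i) a) 0]) ->
  cert q s (f - K_ fm + K_ (d + Lf * gr / (2 * d) * (m%:R * (e / 2)))
    + K_ (Lf / (2 * d) + Lf * gr / (2 * d) * ((\sum_i L i) / (2 * e))) * sqdist a).
Proof.
move=> d0 e0 gr0 Lf0 L0 df dg s0 Hf Hg [x [qx fx dx]].
set G := \sum_i Num.max _ _ in dx.
pose D := Lf * gr / (2 * d).
have D0 : 0 <= D by rewrite divr_ge0 ?mulr_ge0 // ltW.
have i2d : 0 <= (2 * d)^-1 by rewrite invr_ge0 mulr_ge0 // ltW.
have i2e : 0 <= (2 * e)^-1 by rewrite invr_ge0 mulr_ge0 // ltW.
(* Evaluating the certificate [Hf] at the nearby feasible x turns it into a numerical bound on f(x)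
   - f(a), and f(x) >= fm. *)
have num : 0 <= peval f a - fm + d / 2 + D * G.
  have := cert_ge0 qx Hf.
  rewrite /peval mevalB mevalM mevalC rmorphXn /= mevalB mevalC -!/(peval _ _) peval_sqdist => le.
  have le2 : (peval f x - peval f a) ^+ 2 <= Lf * gr * G.
    rewrite -mulrA; apply: le_trans (ler_wpM2l Lf0 dx).
    by rewrite -subr_ge0.
  have : (peval f x - peval f a) <= d / 2 + (2 * d)^-1 * (peval f x - peval f a) ^+ 2.
    rewrite -subr_ge0; move: (peval f x - peval f a) => u.
    have -> : d / 2 + (2 * d)^-1 * u ^+ 2 - u = (2 * d)^-1 * (u - d) ^+ 2.
      by field; rewrite gt_eqF.
    by rewrite mulr_ge0 ?sqr_ge0.
  have := ler_wpM2l i2d le2; rewrite /D; lra.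
have part_f : cert q s (f - K_ (peval f a) + K_ (d / 2) + K_ (Lf / (2 * d)) * sqdist a).
  have -> : f - K_ (peval f a) + K_ (d / 2) + K_ (Lf / (2 * d)) * sqdist a =
    (K_ (d / 2) + (f - K_ (peval f a)) + K_ ((2 * d)^-1) * (f - K_ (peval f a)) ^+ 2) +
    K_ ((2 * d)^-1) * (K_ Lf * sqdist a - (f - K_ (peval f a)) ^+ 2).
    by rewrite rmorphM; ring.
  apply: certD; last exact: certCM.
  by apply: cert_amgm => //; apply: deg_add; rewrite ?degN ?degC.
have part_g i : cert q s (K_ (e / 2 - Num.max (peval (g i) a) 0) + K_ (L i / (2 * e)) * sqdist a).
  (* Without violation at a all terms are nonnegative. Otherwise g_i is added and subtracted: the
     inequality between means handles g_i - g_i(a), and - g_i is a constraint. *)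
  have [ga0|ga0] := leP (peval (g i) a) 0.
    rewrite subr0; apply: certD; first by apply: certC; rewrite divr_ge0 // ltW.
    by apply: certCM; [rewrite mulr_ge0 | exact: cert_sqdist].
  have -> : K_ (e / 2 - peval (g i) a) + K_ (L i / (2 * e)) * sqdist a =
     (K_ (e / 2) + (g i - K_ (peval (g i) a)) + K_ ((2 * e)^-1) * (g i - K_ (peval (g i) a)) ^+ 2) +
     K_ ((2 * e)^-1) * (K_ (L i) * sqdist a - (g i - K_ (peval (g i) a)) ^+ 2) + (- g i).
    by rewrite rmorphB rmorphM; ring.
  apply: certD; first apply: certD; last first.
  - apply: cert_mono (cert_neg_constr i); move: (dg i); rewrite /half_deg uphalf_half => le.
    by have := odd_double_half (deg (g i)); lia.
  - exact: certCM.
  - by apply: cert_amgm => //; apply: deg_add; rewrite ?degN ?degC.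
have -> : f - K_ fm + K_ (d + Lf * gr / (2 * d) * (m%:R * (e / 2)))
    + K_ (Lf / (2 * d) + Lf * gr / (2 * d) * ((\sum_i L i) / (2 * e))) * sqdist a =
  (f - K_ (peval f a) + K_ (d / 2) + K_ (Lf / (2 * d)) * sqdist a) +
  K_ (peval f a - fm + d / 2 + D * G) +
  K_ D * \sum_i (K_ (e / 2 - Num.max (peval (g i) a) 0) + K_ (L i / (2 * e)) * sqdist a).
  rewrite big_split /= -mulr_suml -!rmorph_sum /= -mulr_suml sumrB sumr_const card_ord -/G -/D.
  rewrite -[e / 2 *+ m]mulr_natl.
    have -> : d + D * (m%:R * (e / 2)) = d / 2 + d / 2 + D * (m%:R * (e / 2)) by field.
  by rewrite !(rmorphD, rmorphB, rmorphM); ring.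
apply: certD; first apply: certD => //; first exact: certC.
by apply: certCM => //; apply: cert_sum.
Qed.

End MainCertificate.

Section Rate.
Context (R : realType) (n m : nat) (g : 'I_m -> {mpoly R[n]}) (rad gr : R).
Hypothesis rad0 : 0 < rad.
Hypothesis X_ball : feasible g `<=` [set x | enorm x <= rad].
Hypothesis gr0 : 0 <= gr.
Hypothesis growth : forall a, box rad a -> exists2 x, feasible g x &
  \sum_i (x ord0 i - a ord0 i) ^+ 2 <= gr * \sum_i Num.max (peval (g i) a) 0.

Notation K_ := (@mpolyC n R).
Notation q := (constr rad g).

Definition lincomb k (c : 'N_(n, k) -> R) : {mpoly R[n]} :=
  \sum_a K_ (c a) * mpolyX R a.

Lemma peval_lincomb k (c : 'N_(n, k) -> R) x :
  peval (lincomb c) x = \sum_a c a * peval (mpolyX R a) x.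
Proof.
rewrite /peval raddf_sum; apply: eq_bigr => a _ /=.
by rewrite mevalM mevalC.
Qed.

Lemma deg_lincomb k (c : 'N_(n, k) -> R) : (deg (lincomb c) <= k)%N.
Proof.
apply: deg_sum => a _; apply: leq_trans (degM_le _ _) _.
by rewrite degC degX -ltnS bmdeg.
Qed.

Lemma cert_lipschitz p : exists L s, 0 <= L /\ forall a, box rad a ->
  cert q s (K_ L * sqdist a - (p - K_ (peval p a)) ^+ 2).
Proof.
have [M [L [s [_ L0 _ H]]]] := box_lipschitzT (cert_box g rad) p.
by exists L, s; split => // a /H[].
Qed.

(** Cauchy-Schwarz over the monomials keeps L and the order independent of the coefficients. This
    uniformity lets one order serve all functionals in the moment error. *)
Lemma cert_lipschitz_lincomb k B : 0 <= B ->
  exists L s, 0 <= L /\ forall c : 'N_(n, k) -> R, \sum_a c a ^+ 2 <= B ->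
  forall a, box rad a ->
  cert q s (K_ L * sqdist a - (lincomb c - K_ (peval (lincomb c) a)) ^+ 2).
Proof.
move=> B0.
have /choice[L /choice[s Ls]] (b : 'N_(n, k)) := cert_lipschitz (mpolyX R b).
pose t := (\max_b s b + k + 1)%N.
exists (B * \sum_b L b), t; split.
  by apply: mulr_ge0 => //; apply: sumr_ge0 => b _; case: (Ls b).
move=> c cB a aB; pose u (b : 'N_(n, k)) := mpolyX R b - K_ (peval (mpolyX R b) a).
have du b : (deg (u b) <= k)%N.
  by apply: deg_add; rewrite ?degN ?degC // degX -ltnS bmdeg.
have -> : lincomb c - K_ (peval (lincomb c) a) = \sum_b K_ (c b) * u b.
  rewrite peval_lincomb rmorph_sum -sumrB; apply: eq_bigr => b _.
  by rewrite /= rmorphM mulrBr.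
pose Q := \sum_b u b ^+ 2; pose P := \sum_b K_ (c b) * u b.
(* Lagrange's identity exhibits the Cauchy-Schwarz defect as a sum of squares. *)
have CS : K_ 2 * (K_ (\sum_b c b ^+ 2) * Q - P ^+ 2) =
    \sum_b \sum_b' (K_ (c b) * u b' - K_ (c b') * u b) ^+ 2.
  transitivity (\sum_b \sum_b' (K_ (c b ^+ 2) * u b' ^+ 2) +
     \sum_b \sum_b' (K_ (c b' ^+ 2) * u b ^+ 2)
     - 2 * \sum_b \sum_b' ((K_ (c b) * u b) * (K_ (c b') * u b'))).
    rewrite [X in _ + X - _]exchange_big /= -!big_distrlr /= -/Q -/P -rmorph_sum rmorph_nat; ring.
  rewrite mulr_sumr -big_split -sumrB; apply: eq_bigr => b _ /=.
  rewrite mulr_sumr -big_split -sumrB; apply: eq_bigr => b' _ /=.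
  by rewrite !rmorphXn; ring.
have -> : K_ (B * \sum_b L b) * sqdist a - P ^+ 2 =
   K_ (\sum_b c b ^+ 2) * \sum_b (K_ (L b) * sqdist a - u b ^+ 2) +
   K_ ((B - \sum_b c b ^+ 2) * \sum_b L b) * sqdist a +
   K_ (2^-1) * (K_ 2 * (K_ (\sum_b c b ^+ 2) * Q - P ^+ 2)).
  rewrite sumrB -mulr_suml -rmorph_sum mulrA -rmorphM mulVf ?pnatr_eq0 // rmorph1 mul1r -/Q.
  by rewrite !(rmorphM, rmorphB) /=; ring.
have c0 : 0 <= \sum_b c b ^+ 2 by apply: sumr_ge0 => b _; apply: sqr_ge0.
have L0 : 0 <= \sum_b L b by apply: sumr_ge0 => b _; case: (Ls b).
apply: certD; first apply: certD.
- apply: certCM => //; apply: cert_sum => b _.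
  apply: (@cert_mono _ _ _ _ (s b)); last by case: (Ls b) => _; apply.
  by rewrite /t -addnA (leq_trans (leq_bigmax b)) // leq_addr.
- apply: certCM; first by rewrite mulr_ge0 // subr_ge0.
  by apply: cert_sqdist; rewrite /t addn1.
apply: certCM; first by rewrite invr_ge0.
rewrite CS; apply: cert_sum => b _; apply: cert_sum => b' _; apply: cert_sq.
have dKu x b0 : (deg (K_ x * u b0)%R <= t)%N.
  apply: leq_trans (degM_le _ _) _; rewrite degC add0n (leq_trans (du b0)) //.
  by rewrite /t -addnA addnCA leq_addr.
by apply: deg_add; rewrite ?degN.
Qed.

Lemma cert_rate k B : 0 <= B -> exists C D, [/\ 0 <= C, (0 < D)%N &
  forall N, (0 < N)%N -> forall c : 'N_(n, k) -> R, \sum_a c a ^+ 2 <= B ->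
  forall fm, (forall x, feasible g x -> fm <= peval (lincomb c) x) ->
  cert q (D * N) (lincomb c - K_ fm + K_ (C / Num.sqrt N%:R))].
Proof.
have bound a b c d : [/\ (a <= a + b + c + d + 1)%N, (b <= a + b + c + d + 1)%N,
    (c <= a + b + c + d + 1)%N & (d <= a + b + c + d + 1)%N] by split; lia.
(* For N >= 1 the order is at most a multiple of N, as 2 N + 3 <= 5 N. *)
have degree N s : (0 < N)%N -> (n * (2 * N + 3) + s + 1 <= (5 * n + s + 1) * N)%N by nia.
move=> B0; have [Lf [sf [Lf0 Hf]]] := cert_lipschitz_lincomb k B0.
have /choice[L /choice[sg Hg]] (i : 'I_m) := cert_lipschitz (g i).
have L0 i : 0 <= L i by case: (Hg i).
have [sm Hsm] : exists t, forall i, (sg i <= t)%N.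
  by exists (\max_i sg i) => i; apply: leq_bigmax.
have [dm Hdm] : exists t, forall i, (deg (g i) <= t)%N.
  by exists (\max_i deg (g i)) => i; apply: leq_bigmax.
have [] := bound sf sm dm k; set s := (sf + sm + dm + k + 1)%N => sfs sms dms ks.
pose LG := \sum_i L i; have LG0 : 0 <= LG by apply: sumr_ge0.
pose A := n%:R * rad ^+ 2 * 16.
have A0 : 0 <= A.
  by apply: mulr_ge0 => //; apply: mulr_ge0; [exact: ler0n | exact: sqr_ge0].
(* These are the terms of [E0 + E] below multiplied by sqrt N, with 1 / N replaced by 1. The 16 in
   [A] is half of the 32 of the second moment, the other half cancelling against 1 / (2 d). *)
pose C := 1 + Lf * gr * m%:R / 4 + Lf * A * (1 + gr * LG / 2).
exists C, (5 * n + s + 1)%N.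
split.
- rewrite /C; have := mulr_ge0 Lf0 gr0; have := ler0n R m; have := mulr_ge0 gr0 LG0.
  have := mulr_ge0 Lf0 A0; nra.
- by rewrite addn1.
move=> N N0 c cB fm Hfm.
have NR : (1 : R) <= N%:R by rewrite ler1n.
have N0R : (0 : R) < N%:R by rewrite ltr0n.
pose r : R := Num.sqrt N%:R.
have r2 : r ^+ 2 = N%:R by rewrite sqr_sqrtr ?ler0n.
have r0 : 0 < r by rewrite sqrtr_gt0.
have r1 : 1 <= r by rewrite -sqrtr1 ler_wsqrtr.
pose d := r^-1; pose e : R := N%:R^-1.
have d0 : 0 < d by rewrite invr_gt0.
have e0 : 0 < e by rewrite invr_gt0.
pose E0 := d + Lf * gr / (2 * d) * (m%:R * (e / 2)).
pose E1 := Lf / (2 * d) + Lf * gr / (2 * d) * (LG / (2 * e)).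
have E10 : 0 <= E1.
  have d20 : 0 <= 2 * d by apply: mulr_ge0 => //; exact: ltW.
  have e20 : 0 <= 2 * e by apply: mulr_ge0 => //; exact: ltW.
  by apply: addr_ge0; [exact: divr_ge0 | apply: mulr_ge0; apply: divr_ge0 => //; exact: mulr_ge0].
have near a : box rad a -> cert q s (lincomb c - K_ fm + K_ E0 + K_ E1 * sqdist a).
  move=> aB; apply: cert_near_point => //.
  - exact: leq_trans (deg_lincomb c) ks.
  - by move=> i; apply: leq_trans (Hdm i) dms.
  - by rewrite /s addn1.
  - by apply: (@cert_mono _ _ _ _ sf); [exact: sfs | exact: Hf].
  - move=> i; apply: (@cert_mono _ _ _ _ (sg i)); last by case: (Hg i) => _; apply.
    exact: leq_trans (Hsm i) sms.
  have [x Xx dx] := growth aB; exists x; split => //; last exact: Hfm.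
  by move=> j; apply: (constr_ge0 X_ball (ltW rad0)).
have H := cert_average N0 rad0 (cert_box g rad) E10 near.
have {}H := cert_mono (degree N s N0) H.
set E := E1 * _ in H.
have EC : E0 + E <= C / r.
  have -> : E0 + E = (1 + Lf * gr * m%:R / 4) / r + Lf * A * (r ^- 2 + gr * LG / 2) / r.
    rewrite /E0 /E /E1 /d /e /A -r2; field; rewrite gt_eqF //.
  rewrite /C [leRHS]mulrDl lerD2l ler_pM2r ?invr_gt0 //.
  apply: ler_wpM2l; [exact: mulr_ge0 | rewrite lerD2r].
  by rewrite invf_le1 ?exprn_gt0 // exprn_ege1.
rewrite -/r; move: (C / r) EC => Y EC.
have -> : lincomb c - K_ fm + K_ Y = K_ (Y - (E0 + E)) + (lincomb c - K_ fm + K_ E0 + K_ E).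
  by rewrite rmorphB rmorphD; ring.
by apply: certD => //; apply: certC; rewrite subr_ge0.
Qed.

End Rate.

(** * Pairing with pseudo-moments *)

Section Pairing.
Context (R : realType) (n c : nat) (q : 'I_c -> {mpoly R[n]}).

Notation K_ := (@mpolyC n R).

Section Riesz.
Context (d : nat) (y : {ffun 'N_(n, d) -> R}).

Lemma rieszD p p' : riesz y (p + p') = riesz y p + riesz y p'.
Proof.
by rewrite /riesz -big_split; apply: eq_bigr => a _ /=; rewrite mcoeffD mulrDl.
Qed.

Lemma rieszCM b p : riesz y (K_ b * p) = b * riesz y p.
Proof.
by rewrite /riesz mulr_sumr; apply: eq_bigr => a _ /=; rewrite mcoeffCM mulrA.
Qed.

Lemma riesz0 : riesz y 0 = 0.
Proof. by rewrite /riesz big1 // => a _; rewrite mcoeff0 mul0r. Qed.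

Lemma riesz_sum (I : Type) (r : seq I) (F : I -> {mpoly R[n]}) :
  riesz y (\sum_(i <- r) F i) = \sum_(i <- r) riesz y (F i).
Proof. by apply: (big_morph _ rieszD riesz0). Qed.

Lemma rieszC b : riesz y (K_ b) = b * y bm0.
Proof.
rewrite /riesz (bigD1 bm0) //= mcoeffC eqxx mulr1 big1 ?addr0 // => a a0.
by rewrite mcoeffC; move: a0; rewrite bmeqP => /negbTE->; rewrite mulr0 mul0r.
Qed.

Lemma riesz_subC p b : riesz y (p - K_ b) = riesz y p - b * y bm0.
Proof. by rewrite -rmorphN rieszD rieszC mulNr. Qed.

End Riesz.

Lemma mpoly_lowdeg d (u : {mpoly R[n]}) : (deg u <= d)%N ->
  u = \sum_(a : 'N_(n, d)) K_ (mcoeff a u) * mpolyX R a.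
Proof.
move=> ud; apply/mpolyP => b; rewrite raddf_sum /=.
have [bd|db] := leqP (mdeg b) d.
  rewrite (bigD1 (@BMultinom n d.+1 b bd)) //= mcoeffCM mcoeffX eqxx mulr1 big1 ?addr0 // => a ab.
  rewrite mcoeffCM mcoeffX; suff -> : (bmnm a == b) = false by rewrite mulr0.
  by apply: contraNF ab => /eqP E; rewrite bmeqP /= E.
rewrite big1 => [|a _].
  by apply: memN_msupp_eq0; apply/negP => /(deg_msupp ud); rewrite leqNgt db.
rewrite mcoeffCM mcoeffX; suff -> : (bmnm a == b) = false by rewrite mulr0.
by apply/eqP => E; have := bmdeg a; rewrite E ltnS leqNgt db.
Qed.

(** The value of y at u^2 q_J is the quadratic form of the localizing matrix at the coefficient
    vector of u, which fits because u has degree at most r - [half_deg] of q_J. *)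
Lemma pseudo_moments_cert r y p : @pseudo_moments _ _ _ q r y -> cert q r p -> 0 <= riesz y p.
Proof.
move=> [_ _ psdJ]; elim => [|u J p1 us _ IH]; first by rewrite riesz0.
rewrite rieszD addr_ge0 //.
have Jr : (half_deg (prod_constr q J) <= r)%N by apply: leq_trans us; rewrite leq_addl.
have ud : (deg u <= r - half_deg (prod_constr q J))%N by rewrite leq_subRL // addnC.
have [_ /(_ (fun a => mcoeff a u))] := psdJ J Jr.
congr (_ <= _); rewrite [in RHS](mpoly_lowdeg ud) expr2 big_distrlr /= mulr_suml riesz_sum.
apply: eq_bigr => a _; rewrite mulr_suml riesz_sum; apply: eq_bigr => b _.
rewrite /moment_matrix -rieszCM mulrC -rieszCM; congr riesz.
by rewrite mpolyXD; ring.
Qed.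

Definition dirac_moments d (x : 'rV[R]_n) : {ffun 'N_(n, d) -> R} :=
  [ffun a : 'N_(n, d) => peval (mpolyX R a) x].

Lemma riesz_dirac d x p : (deg p <= d)%N -> riesz (dirac_moments d x) p = peval p x.
Proof.
move=> pd; rewrite [in RHS](mpoly_lowdeg pd) /riesz /peval raddf_sum /=.
by apply: eq_bigr => a _; rewrite ffunE mevalM mevalC.
Qed.

Lemma uphalf_slack d a b r : (uphalf d <= r)%N -> (a <= r - uphalf d)%N ->
  (b <= r - uphalf d)%N -> (d + (a + b) <= 2 * r)%N.
Proof. have := odd_double_half d; rewrite uphalf_half; lia. Qed.

(** Each localizing matrix is the number q_J(x) >= 0 times a rank-one matrix. Its entries involve
    degrees at most 2 r, so [riesz] drops no coefficient. *)
Lemma dirac_pseudo_moments r x : (forall j, 0 <= peval (q j) x) ->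
  @pseudo_moments _ _ _ q r (dirac_moments (2 * r) x).
Proof.
move=> qx.
have psd1 J : (half_deg (prod_constr q J) <= r)%N ->
    psd (@moment_matrix R n (2 * r) (r - half_deg (prod_constr q J))
      (dirac_moments (2 * r) x) (prod_constr q J)).
  move=> Jr; set t := (r - _)%N.
  have Me (a b : 'N_(n, t)) : moment_matrix (dirac_moments (2 * r) x) (prod_constr q J) a b =
      peval (prod_constr q J) x * (peval (mpolyX R a) x * peval (mpolyX R b) x).
    rewrite /moment_matrix riesz_dirac; first by rewrite /peval mevalM mpolyXD mevalM.
    apply: leq_trans (degM_le _ _) _; rewrite degX mdegD.
    by apply: uphalf_slack Jr _ _; rewrite -ltnS; apply: bmdeg.
  split=> [a b|v]; first by rewrite !Me [X in _ * X]mulrC.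
  have -> : \sum_a \sum_b
      v a * moment_matrix (dirac_moments (2 * r) x) (prod_constr q J) a b * v b =
      peval (prod_constr q J) x * (\sum_(a : 'N_(n, t)) v a * peval (mpolyX R a) x) ^+ 2.
    rewrite expr2 big_distrlr mulr_sumr; apply: eq_bigr => a _.
    by rewrite mulr_sumr; apply: eq_bigr => b _; rewrite Me /=; ring.
  rewrite mulr_ge0 ?sqr_ge0 //.
  rewrite /peval /prod_constr rmorph_prod; apply: prodr_ge0 => j _; exact: qx.
split=> //.
  by rewrite ffunE /peval mevalX big1 // => i _; rewrite mnm0E expr0.
have := psd1 finset.set0; rewrite prod_constr0 half_deg1 subn0; exact.
Qed.

End Pairing.

(** * Growth conditions *)

Section Growth.
Context (R : realType) (n m : nat) (g : 'I_m -> {mpoly R[n]}).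
Implicit Types (x y a : 'rV[R]_n).

Lemma peval_continuous (p : {mpoly R[n]}) : continuous (peval p).
Proof.
move: p; apply: mpoly_ring_ind => [b|i|p1 p2 h1 h2|p1 p2 h1 h2].
- by rewrite (_ : peval _ = cst b);
    [exact: cst_continuous | apply/funext => x; rewrite /peval mevalC].
- rewrite (_ : peval _ = (fun x : 'rV[R]_n => x ord0 i)); first exact: coord_continuous.
  by apply/funext => x; rewrite /peval mevalXU.
- rewrite (_ : peval _ = peval p1 \+ peval p2).
    by move=> x; apply: continuousD; [exact: h1 | exact: h2].
  by apply/funext => x; rewrite /peval mevalD.
- rewrite (_ : peval _ = peval p1 \* peval p2).
    by move=> x; apply: continuousM; [exact: h1 | exact: h2].
  by apply/funext => x; rewrite /peval mevalM.
Qed.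

Definition dist2 x y : R := \sum_i (x ord0 i - y ord0 i) ^+ 2.

Lemma dist2_ge0 x y : 0 <= dist2 x y.
Proof. by apply: sumr_ge0 => i _; apply: sqr_ge0. Qed.

Lemma dist2_continuous y : continuous (dist2^~ y).
Proof.
rewrite (_ : dist2^~ y = peval (sqdist y)); first exact: peval_continuous.
by apply/funext => x; rewrite peval_sqdist.
Qed.

Lemma dist2_coord x y i : (x ord0 i - y ord0 i) ^+ 2 <= dist2 x y.
Proof. by rewrite /dist2 (bigD1 i) //= lerDl; apply: sumr_ge0 => j _; apply: sqr_ge0. Qed.

Lemma dist2xx x : dist2 x x = 0.
Proof. by rewrite /dist2 big1 // => i _; rewrite subrr expr0n. Qed.

Lemma dist2_eq0 x y : dist2 x y = 0 -> x = y.
Proof.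
move=> xy0; apply/rowP => i; apply/eqP; rewrite -subr_eq0 -sqrf_eq0 eq_le sqr_ge0 andbT.
by rewrite -xy0 dist2_coord.
Qed.

Lemma enorm_sub_sq x y : enorm (x - y) ^+ 2 = dist2 x y.
Proof.
have -> : dist2 x y = \sum_i (x - y) ord0 i ^+ 2 by apply: eq_bigr => i _; rewrite !mxE.
by rewrite sqr_sqrtr //; apply: sumr_ge0 => i _; apply: sqr_ge0.
Qed.

Lemma max_violation_ge0 x : 0 <= max_violation g x.
Proof.
by rewrite /max_violation; elim/big_rec: _ => // i u _ u0; rewrite le_max u0 orbT.
Qed.

Lemma max_violation_ge x i : peval (g i) x <= max_violation g x.
Proof. by rewrite /max_violation (bigD1 i) //= le_max lexx. Qed.

Lemma max_violation_le0 x : max_violation g x <= 0 -> feasible g x.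
Proof. by move=> Gx i; apply: le_trans Gx; apply: max_violation_ge. Qed.

Definition total_violation x : R := \sum_i Num.max (peval (g i) x) 0.

Lemma le_total_violation x i : peval (g i) x <= total_violation x.
Proof.
rewrite /total_violation (bigD1 i) //= -[X in X <= _]addr0 lerD //.
  by rewrite le_max lexx.
by apply: sumr_ge0 => j _; rewrite le_max lexx orbT.
Qed.

Lemma total_violation_ge0 x : 0 <= total_violation x.
Proof. by apply: sumr_ge0 => i _; rewrite le_max lexx orbT. Qed.

Lemma max_violation_le_total x : max_violation g x <= total_violation x.
Proof.
rewrite /max_violation; elim/big_ind: _ => [|u v ux vx|i _].
- exact: total_violation_ge0.
- by rewrite ge_max ux.
- exact: le_total_violation.
Qed.

Lemma max_violation_continuous : continuous (max_violation g).
Proof.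
rewrite /max_violation; elim: (index_enum _) => [|i r IH].
  rewrite (_ : (fun _ => _) = cst 0); first exact: cst_continuous.
  by apply/funext => x; rewrite big_nil.
rewrite (_ : (fun _ => _) =
  peval (g i) \max (fun x => \big[Num.max/0]_(i <- r) peval (g i) x)).
  by move=> x; apply: continuous_max; [exact: peval_continuous | exact: IH].
by apply/funext => x; rewrite big_cons.
Qed.

(** The difference quotient is at least - K |y - x|, which tends to 0. *)
Lemma frechet_subdiff_quadratic (F : 'rV[R]_n -> R) x w K : 0 <= K ->
  (forall y, F x + dotv w (y - x) - K * dist2 y x <= F y) ->
  frechet_subdiff F x w.
Proof.
move=> K0 H; rewrite /frechet_subdiff /= limf_einfE.
apply/lee_subgt0Pr => e e0; rewrite sub0e.
apply: le_ereal_sup_tmp.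
(* The radius e / (K + 1) makes K |y - x| <= e and stays meaningful for K = 0. *)
have e1 : 0 < (e / (K + 1)) ^+ 2 by rewrite exprn_gt0 // divr_gt0 // ltr_wpDl.
exists (ereal_inf ((fun y => ((F y - F x - dotv w (y - x)) / enorm (y - x))%:E) @`
   [set y | y != x /\ dist2 y x < (e / (K + 1)) ^+ 2])).
  exists [set y | y != x /\ dist2 y x < (e / (K + 1)) ^+ 2] => //.
  rewrite /dnbhs /within /=.
  have d0 : dist2 x x < (e / (K + 1)) ^+ 2.
    by rewrite dist2xx.
  have : \forall y \near x, dist2 y x < (e / (K + 1)) ^+ 2.
    by apply: (@cvgr_lt R _ (nbhs x) _ (dist2^~ x) (dist2 x x)) => //; exact: dist2_continuous.
  by apply: filterS => y yx yneq; split.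
apply: le_ereal_inf_tmp => _ [y [yx dyx] <-]; rewrite lee_fin.
have s0 : 0 < enorm (y - x).
  rewrite lt0r sqrtr_ge0 andbT; apply: contraNneq yx => E.
  by apply/eqP/dist2_eq0; rewrite -enorm_sub_sq E expr0n.
rewrite ler_pdivlMr //.
have := H y; rewrite -enorm_sub_sq.
have : enorm (y - x) < e / (K + 1).
  by rewrite -ltr_sqr ?nnegrE ?enorm_sub_sq // ltW // divr_gt0 // ltr_wpDl.
rewrite ltr_pdivlMr ?ltr_wpDl // => sK.
have : K * enorm (y - x) ^+ 2 <= e * enorm (y - x).
  by rewrite expr2 mulrA ler_wpM2r // ?ltW //; nra.
lra.
Qed.

Lemma box_compact a (r : R) :
  compact [set x : 'rV[R]_n | forall i, x ord0 i \in `[a ord0 i - r, a ord0 i + r]].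
Proof.
apply: (@rV_compact R n (fun i => [set` `[a ord0 i - r, a ord0 i + r]])) => i.
exact: segment_compact.
Qed.

Lemma compact_min (A : set 'rV[R]_n) (F : 'rV[R]_n -> R) :
  A !=set0 -> compact A -> continuous F -> exists2 c, A c & forall x, A x -> F c <= F x.
Proof.
move=> A0 cA cF; have cW : {within A, continuous F} by exact: continuous_subspaceT.
have [c /set_mem Ac Hc] := compact_EVT_min A0 cA cW.
by exists c => // x /mem_set; apply: Hc.
Qed.

(* Minimise sqrt(G(y)) + b |y - a|^2: if the minimiser y had G(y) > 0, squaring
   the minimality would yield a subgradient of G at y that is too short for the
   Polyak-Lojasiewicz inequality. *)
Lemma pl_growth : feasible g !=set0 -> polyak_lojasiewicz (max_violation g) ->
  exists2 gr : R, 0 <= gr & forall a, exists2 x, feasible g x & dist2 x a <= gr * total_violation a.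
Proof.
set G := max_violation g.
move=> [x0 Xx0] [mu mu0 PL]; exists (16 / mu); first by rewrite divr_ge0 // ltW.
move=> a; pose s := Num.sqrt (G a).
have Ga0 : 0 <= G a by apply: max_violation_ge0.
have s2 : s ^+ 2 = G a by rewrite sqr_sqrtr.
have [s0|s0] := eqVneq s 0.
  exists a; first by apply: max_violation_le0; rewrite -/G -s2 s0 expr0n.
  rewrite dist2xx; apply: mulr_ge0; last exact: total_violation_ge0.
  by rewrite divr_ge0 // ltW.
have {}s0 : 0 < s by rewrite lt0r s0 sqrtr_ge0.
(* Chosen so that 8 b s / mu = 1/2, which contradicts the Polyak-Lojasiewicz inequality at the end;
   moreover s / b = (16 / mu) G(a) is the announced growth bound. *)
pose b := mu / (16 * s); have b0 : 0 < b by rewrite divr_gt0 // mulr_gt0.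
pose phi y := Num.sqrt (G y) + b * dist2 y a.
have cphi : continuous phi.
  move=> y; apply: (@continuousD _ _ _ (Num.sqrt \o G) (cst b \* (dist2^~ a)) y).
    by apply: continuous_comp; [exact: max_violation_continuous | exact: sqrt_continuous].
  by apply: continuousM; [exact: cst_continuous | exact: dist2_continuous].
have phia : phi a = s by rewrite /phi dist2xx mulr0 addr0.
(* Outside the cube of half-width r the quadratic term alone reaches s = phi(a), so a minimiser over
   the cube is global. *)
pose r := Num.sqrt (s / b).
have r2 : r ^+ 2 = s / b by rewrite sqr_sqrtr // divr_ge0 // ltW.
pose Q := [set x : 'rV[R]_n | forall i, x ord0 i \in `[a ord0 i - r, a ord0 i + r]].
have Qa : Q a by move=> i; rewrite in_itv /= lerBlDr lerDl sqrtr_ge0.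
have [y Qy miny] : exists2 y, Q y & forall x, phi y <= phi x.
  have [y Qy Hy] := compact_min (ex_intro _ a Qa) (@box_compact a r) cphi.
  exists y => // x; have [/Hy//|/existsNP[i xi]] := pselect (Q x).
  apply: le_trans (Hy _ Qa) _; rewrite phia /phi.
  have : s <= b * dist2 x a.
    rewrite mulrC -ler_pdivrMr // -r2; apply: le_trans (dist2_coord _ _ i).
    have r0 : 0 <= r by apply: sqrtr_ge0.
    move/negP: xi; rewrite in_itv /= negb_and -!ltNge => /orP[]; nra.
  by have := sqrtr_ge0 (G x); lra.
pose t := Num.sqrt (G y); have t0 : 0 <= t by apply: sqrtr_ge0.
have Gy0 : 0 <= G y by apply: max_violation_ge0.
have t2 : t ^+ 2 = G y by rewrite sqr_sqrtr.
have ty : t + b * dist2 y a <= s by rewrite -phia; apply: miny.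
have [tz|tz] := eqVneq t 0.
  exists y; first by apply: max_violation_le0; rewrite -/G -t2 tz expr0n.
  apply: (@le_trans _ _ (16 / mu * G a)); last first.
    by apply: ler_wpM2l; [rewrite divr_ge0 // ltW | apply: max_violation_le_total].
  have : dist2 y a <= s / b by rewrite ler_pdivlMr // mulrC -[X in X <= _]add0r -{1}tz.
  rewrite -s2 /b; have -> : s / (mu / (16 * s)) = 16 / mu * s ^+ 2 by field; rewrite !gt_eqF.
  by [].
have {}t0 : 0 < t by rewrite lt0r tz.
(* With v = sqrt(G(z)), v^2 >= t^2 + 2 t (v - t), and minimality bounds v - t below by b (|y - a|^2
   - |z - a|^2); w is the linear part of the result at y. *)
pose w : 'rV[R]_n := - (4 * t * b) *: (y - a).
have Fw : frechet_subdiff G y w.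
  apply: (@frechet_subdiff_quadratic _ _ _ (2 * t * b));
    first by rewrite ltW // mulr_gt0 // mulr_gt0.
  move=> z; have := miny z; rewrite /phi -/t => tz'.
  have Ez : dist2 z a = dist2 y a + 2 * dotv (y - a) (z - y) + dist2 z y.
    rewrite /dist2 /dotv mulr_sumr -!big_split /=; apply: eq_bigr => i _; rewrite !mxE; ring.
  have Ew : dotv w (z - y) = - (4 * t * b) * dotv (y - a) (z - y).
    rewrite /dotv mulr_sumr; apply: eq_bigr => i _; rewrite !mxE; ring.
  have Gz : G z = Num.sqrt (G z) ^+ 2 by rewrite sqr_sqrtr // max_violation_ge0.
  rewrite Ew Gz -t2; set v := Num.sqrt (G z) in tz' *; rewrite Ez in tz'.
  have := sqr_ge0 (v - t); move: (dotv _ _) (dist2 z y) tz' => P D tz' vt.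
  have : 0 <= 2 * t * (v + b * (dist2 y a + 2 * P + D) - (t + b * dist2 y a)).
    by apply: mulr_ge0; [rewrite ltW // mulr_gt0 | rewrite subr_ge0].
  lra.
have Lw : limiting_subdiff G y w.
  by exists (fun=> y), (fun=> w); split; [exact: cvg_cst | exact: cvg_cst | | exact: cvg_cst].
have inf0 : inf (range G) <= 0.
  have -> : 0 = G x0.
    apply/le_anti; rewrite max_violation_ge0 andTb /G /max_violation.
    by elim/big_ind: _ => [|u v u0 v0|i _] //; rewrite ge_max u0.
  by apply: ge_inf; [exists 0 => _ [z _ <-]; apply: max_violation_ge0 | exists x0].
have := PL _ _ Lw.
have -> : enorm w ^+ 2 = (4 * t * b) ^+ 2 * dist2 y a.
  rewrite sqr_sqrtr; last by apply: sumr_ge0 => i _; apply: sqr_ge0.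
  by rewrite /dist2 mulr_sumr; apply: eq_bigr => i _; rewrite !mxE; ring.
rewrite -t2 => le.
have bD : b * dist2 y a <= s by lra.
have : (2 * mu)^-1 * ((4 * t * b) ^+ 2 * dist2 y a) <= t ^+ 2 / 2.
  have -> : (2 * mu)^-1 * ((4 * t * b) ^+ 2 * dist2 y a) = t ^+ 2 * (8 * b / mu) * (b * dist2 y a).
    by field; rewrite gt_eqF.
  have -> : t ^+ 2 / 2 = t ^+ 2 * (8 * b / mu) * s.
    by rewrite /b; field; rewrite !gt_eqF.
  apply: ler_wpM2l => //; apply: mulr_ge0; first exact: sqr_ge0.
  by rewrite divr_ge0 // ?ltW // mulr_gt0.
have := exprn_gt0 2 t0; lra.
Qed.

End Growth.

Section StrongGrowth.
Context (R : realType) (n m : nat) (g : 'I_m -> {mpoly R[n]}).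
Implicit Types (x y a : 'rV[R]_n).

Lemma total_violation_continuous : continuous (total_violation g).
Proof.
rewrite /total_violation; elim: (index_enum _) => [|i r IH].
  rewrite (_ : (fun _ => _) = cst 0); first exact: cst_continuous.
  by apply/funext => x; rewrite big_nil.
rewrite (_ : (fun _ => _) = (fun x => (peval (g i) \max cst 0) x +
    \sum_(i <- r) Num.max (peval (g i) x) 0)).
  move=> x; apply: continuousD; last exact: IH.
  by apply: continuous_max; [exact: peval_continuous | exact: cst_continuous].
by apply/funext => x; rewrite big_cons.
Qed.

Lemma total_violation_le0 x : total_violation g x <= 0 -> feasible g x.
Proof. by move=> le i; apply: le_trans le; apply: le_total_violation. Qed.

Lemma le_total_violation_feasible x y mu : 0 <= mu -> feasible g y -> forall i,
  mu <= peval (g i) x + peval (g i) y -> mu <= total_violation g x.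
Proof.
move=> mu0 Xy i le; have := Xy i; have := le_total_violation g x i; lra.
Qed.

(* The projection y of a point x of Omega onto the feasible set satisfies
   g_i((x + y) / 2) > 0 for some i. *)
Lemma strong_convexity_growth (Omega : set 'rV[R]_n) x :
  feasible g !=set0 -> compact (feasible g) -> convex_set Omega ->
  feasible g `<=` Omega -> forall mu, 0 < mu ->
  (forall x y i, Omega x -> Omega y ->
      peval (g i) x + dotv (grad (g i) x) (y - x) + mu / 2 * enorm (y - x) ^+ 2
        <= peval (g i) y) ->
  Omega x -> exists2 y, feasible g y & dist2 y x <= 4 / mu * total_violation g x.
Proof.
move=> X0 cX cvx XO mu mu0 sc Ox.
have [y Xy ymin] := compact_min X0 cX (@dist2_continuous _ _ x).
exists y => //; pose z := 2^-1 *: (x + y).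
have Oz : Omega z.
  have h0 : 0 <= 2^-1 :> R by rewrite invr_ge0.
  have h1 : 2^-1 <= 1 :> R by rewrite invf_le1 // ler1n.
  have := set_mem (cvx x y (Itv01 h0 h1) (mem_set Ox) (mem_set (XO _ Xy))).
  congr (Omega _); rewrite /z scalerDr; congr (_ + _ *: _).
  by rewrite /= /mathcomp.classical.unstable.onem; field.
have zx : dist2 z x = dist2 y x / 4.
  by rewrite /dist2 mulr_suml; apply: eq_bigr => i _; rewrite !mxE; field.
have xz : dist2 x z = dist2 y x / 4.
  by rewrite /dist2 mulr_suml; apply: eq_bigr => i _; rewrite !mxE; field.
have yz : dist2 y z = dist2 y x / 4.
  by rewrite /dist2 mulr_suml; apply: eq_bigr => i _; rewrite !mxE; field.
(* A feasible midpoint would be at half the distance from x, so minimality forces that distance to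
   be 0. *)
have [Xz|] := pselect (feasible g z).
  have := ymin _ Xz; rewrite zx => le.
  have := dist2_ge0 y x; have := total_violation_ge0 g x.
  have : 0 <= 4 / mu by rewrite divr_ge0 // ltW.
  move=> h1 h2 h3; have := mulr_ge0 h1 h2; lra.
move=> /existsNP[i /negP]; rewrite -ltNge => gz.
(* The gradient terms at the midpoint cancel, so adding the two inequalities gives g_i(x) + g_i(y)
   >= (mu / 4) |y - x|^2, whence the constant 4 / mu. *)
have lin : dotv (grad (g i) z) (x - z) + dotv (grad (g i) z) (y - z) = 0.
  by rewrite /dotv -big_split big1 //= => j _; rewrite !mxE; field.
have := sc z x i Oz Ox; have := sc z y i Oz (XO _ Xy).
rewrite !enorm_sub_sq xz yz => h1 h2.
have mu4 : 0 < mu / 4 by rewrite divr_gt0.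
rewrite -(ler_pM2l mu4) mulrA -[4 / mu]invf_div mulfV ?gt_eqF // mul1r.
apply: (@le_total_violation_feasible x y _ _ Xy i); last by lra.
by rewrite mulr_ge0 ?dist2_ge0 // ltW.
Qed.

Lemma feasible_ball_box (rad : R) : feasible g `<=` [set x | enorm x <= rad] ->
  feasible g `<=` box rad.
Proof.
move=> XB x /XB/= xr i; apply: le_trans xr; rewrite /enorm /norm2 -sqrtr_sqr ler_wsqrtr //.
by rewrite (bigD1 i) //= lerDl; apply: sumr_ge0 => j _; apply: sqr_ge0.
Qed.

(** Strong convexity covers Omega only. The rest of the box lies in a compact set disjoint from X,
    where the violation has a positive lower bound v; there the bound n (2 rad)^2 on squared
    distances in the box, divided by v, does the job. *)
Lemma strong_growth (Omega : set 'rV[R]_n) (rad : R) :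
  feasible g !=set0 -> compact (feasible g) -> convex_set Omega ->
  feasible g `<=` interior Omega -> 0 <= rad ->
  feasible g `<=` [set x | enorm x <= rad] -> strongly_convex_on Omega g ->
  exists2 gr : R, 0 <= gr & forall a, box rad a ->
    exists2 x, feasible g x & dist2 x a <= gr * total_violation g a.
Proof.
move=> X0 cX cvx XO r0 XB [mu mu0 sc].
have XO' : feasible g `<=` Omega by move=> x /XO/interior_subset.
pose Q := [set a : 'rV[R]_n | forall i,
  a ord0 i \in `[(0 : 'rV[R]_n) ord0 i - rad, (0 : 'rV[R]_n) ord0 i + rad]].
have cQ : compact Q by exact: box_compact.
pose K := Q `&` ~` interior Omega.
have cK : compact K.
  apply: (@subclosed_compact _ _ Q) => //.
  - apply: closedI; last by apply: open_closedC; exact: open_interior.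
    by apply: compact_closed; [exact: norm_hausdorff | ].
  - by move=> a [].
have boxE a : box rad a -> Q a.
  by move=> aB i; rewrite in_itv /= !mxE sub0r add0r -ler_norml; apply: aB.
have [v v0 Kv] : exists2 v : R, 0 < v & forall a, K a -> v <= total_violation g a.
  have [K0|/set0P/negP/negPn/eqP K0] := pselect (K !=set0).
    have [c Kc cmin] := compact_min K0 cK total_violation_continuous.
    exists (total_violation g c) => //; rewrite lt_neqAle total_violation_ge0 andbT eq_sym.
    apply/eqP => gc0; case: Kc => _; apply; apply: XO; apply: total_violation_le0.
    by rewrite gc0.
  by exists 1 => // a; rewrite K0.
have [x0 Xx0] := X0.
exists (4 / mu + n%:R * (2 * rad) ^+ 2 / v).
  by rewrite addr_ge0 // divr_ge0 ?mulr_ge0 ?sqr_ge0 ?ler0n // ltW.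
move=> a aB.
have T0 := total_violation_ge0 g a.
have i1 : 0 <= 4 / mu by rewrite divr_ge0 // ltW.
have i2 : 0 <= n%:R * (2 * rad) ^+ 2 by rewrite mulr_ge0 ?ler0n ?sqr_ge0.
have [Oa|Oa] := pselect (Omega a).
  have [x Xx le] := strong_convexity_growth X0 cX cvx XO' mu0 sc Oa.
  exists x => //; apply: le_trans le _; rewrite [leRHS]mulrDl lerDl.
  by apply: mulr_ge0 => //; apply: divr_ge0 => //; exact: ltW.
have va : v <= total_violation g a.
  apply: Kv; split; first exact: boxE.
  by move=> /interior_subset/Oa.
exists x0 => //; apply: (@le_trans _ _ (n%:R * (2 * rad) ^+ 2)).
  rewrite /dist2 -[n in n%:R]card_ord -sumr_const mulr_suml; apply: ler_sum => i _.
  rewrite mul1r; have := feasible_ball_box XB Xx0 i; have := aB i.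
  by rewrite !ler_norml => /andP[? ?] /andP[? ?]; nra.
rewrite [leRHS]mulrDl -[X in X <= _]add0r; apply: lerD; first exact: mulr_ge0.
by rewrite mulrAC ler_pdivlMr // ler_wpM2l.
Qed.

End StrongGrowth.

(** * Moments of probability measures *)

Section Mixture.
Local Open Scope ereal_scope.
Context d (T : measurableType d) (R : realType).
Variables (t : {i01 R}) (mu nu : probability T R).

Let t0 : (0 <= 1 - t%:num)%R. Proof. by rewrite subr_ge0. Qed.

Definition mixture : set T -> \bar R :=
  measure_add (mscale (NngNum t0) mu) (mscale (NngNum (ge0 t)) nu).

HB.instance Definition _ := Measure.on mixture.

Lemma mixtureE A : mixture A = (1 - t%:num)%:E * mu A + t%:num%:E * nu A.
Proof. by rewrite /mixture measure_addE. Qed.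

Let mixtureT : mixture setT = 1.
Proof. by rewrite mixtureE !probability_setT !mule1 -EFinD subrK. Qed.

HB.instance Definition _ := Measure_isProbability.Build _ _ _ mixture mixtureT.

(** Positive and negative parts scale separately; integrability makes both finite, so the factor
    distributes over their difference. *)
Lemma integrable_mscale (k : {nonneg R}) (la : probability T R) (D : set T)
    (f : T -> \bar R) : measurable D -> la.-integrable D f ->
  (mscale k la).-integrable D f /\
  \int[mscale k la]_(x in D) f x = k%:num%:E * \int[la]_(x in D) f x.
Proof.
move=> mD If; have /integrableP[mf If_lty] := If.
split.
  apply/integrableP; split=> //.
  rewrite ge0_integral_mscale //; last first.
    exact: measurableT_comp.
  by rewrite lte_mul_pinfty.
have fp := integrable_fin_num mD (integrable_funepos mD If).
have fn := integrable_fin_num mD (integrable_funeneg mD If).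
have fin_mulB (a x y : \bar R) : a \is a fin_num -> x \is a fin_num -> y \is a fin_num ->
    a * x - a * y = a * (x - y).
  by move=> af xf yf; rewrite muleBr // fin_num_adde_defr.
rewrite integralE [in RHS]integralE !ge0_integral_mscale //.
- exact: fin_mulB.
- exact: measurable_funeneg.
- exact: measurable_funepos.
Qed.

Lemma Rintegral_mixture (D : set T) (f : T -> R) : measurable D ->
  mu.-integrable D (EFin \o f) -> nu.-integrable D (EFin \o f) ->
  Rintegral mixture D f = ((1 - t%:num) * Rintegral mu D f + t%:num * Rintegral nu D f)%R.
Proof.
move=> mD If Ig.
have [If' E1] := integrable_mscale (NngNum t0) mD If.
have [Ig' E2] := integrable_mscale (NngNum (ge0 t)) mD Ig.
have f1 := integrable_fin_num mD If; have f2 := integrable_fin_num mD Ig.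
rewrite /Rintegral /mixture integral_measure_add //.
rewrite E1 E2 fineD ?fin_numM // !fineM //.
Qed.

End Mixture.

Section TrueMoments.
Context (R : realType) (n k : nat) (X : set 'rV[R]_n).
Hypothesis cX : compact X.

Notation borel := (g_sigma_algebraType (@open 'rV[R]_n)).

Lemma measurable_compact : measurable (X : set borel).
Proof.
rewrite -[X]setCK; apply: measurableC; apply: sub_sigma_algebra.
by apply: closed_openC; apply: compact_closed => //; exact: norm_hausdorff.
Qed.

Lemma measurable_peval (p : {mpoly R[n]}) : measurable_fun (X : set borel) (peval p).
Proof.
apply: (@measurable_funS _ _ _ _ setT) => //.
apply: (measurability _ (RGenOpens.measurableE R)).
move=> _ [_ [a [b ->] <-]]; rewrite setTI; apply: sub_sigma_algebra.
by move: (@peval_continuous _ _ p) => /continuousP; apply; exact: interval_open.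
Qed.

Lemma integrable_peval (mu : probability borel R) (p : {mpoly R[n]}) :
  mu.-integrable (X : set borel) (EFin \o peval p).
Proof.
apply: measurable_bounded_integrable.
- exact: measurable_compact.
- by apply: le_lt_trans (probability_le1 _ measurable_compact) _; rewrite ltry.
- exact: measurable_peval.
have /compact_bounded[M [Mreal HM]] : compact (peval p @` X).
  apply: continuous_compact => //.
  by apply: continuous_subspaceT; exact: peval_continuous.
by exists M; split => // r Mr x Xx; apply: HM => //; exists x.
Qed.

Lemma dirac_true_moments x : X x ->
  @true_moments R n X k (dirac_moments k x).
Proof.
move=> Xx; exists (\d_(x : borel)) => /=; first by rewrite diracE mem_set.
apply/ffunP => a; rewrite !ffunE /Rintegral integral_dirac.
- by rewrite diracE mem_set // mul1e.
- exact: measurable_compact.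
- by apply/measurable_EFinP; exact: measurable_peval.
Qed.

Lemma true_moments_convex y z t : 0 <= t <= 1 ->
  @true_moments R n X k y -> @true_moments R n X k z ->
  @true_moments R n X k [ffun a => (1 - t) * y a + t * z a].
Proof.
move=> /andP[t0 t1] [mu muX <-] [nu nuX <-].
exists (mixture (Itv01 t0 t1) mu nu) => /=.
  by rewrite mixtureE muX nuX !mule1 -EFinD /= subrK.
apply/ffunP => a; rewrite !ffunE Rintegral_mixture //.
- exact: measurable_compact.
- exact: integrable_peval.
- exact: integrable_peval.
Qed.

End TrueMoments.

(** * Distance to a convex set and rates *)

Section SupportFunction.
Context (R : realType) (I : finType) (Z : set {ffun I -> R}).

(* Test the functional - (Y - z) / |Y - z| at a near-minimiser z of |Y - z|. *)
Lemma inf_norm2_le (Y : {ffun I -> R}) (W e : R) : 0 <= e ->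
  (forall y z t, 0 <= t <= 1 -> Z y -> Z z ->
     Z [ffun a => (1 - t) * y a + t * z a]) ->
  (forall c : I -> R, \sum_a c a ^+ 2 <= 1 -> exists z, [/\ Z z,
     \sum_a (Y a - z a) ^+ 2 <= W & \sum_a c a * z a <= \sum_a c a * Y a + e]) ->
  (ereal_inf [set (norm2 (fun a => Y a - z a))%:E | z in Z] <= e%:E)%E.
Proof.
move=> e0 cvx supp; rewrite leNgt; apply/negP.
pose N z : R := norm2 (fun a => Y a - z a).
have N2 z : N z ^+ 2 = \sum_a (Y a - z a) ^+ 2.
  by rewrite sqr_sqrtr //; apply: sumr_ge0 => a _; apply: sqr_ge0.
have N0 z : 0 <= N z by apply: sqrtr_ge0.
have [|z0 [Zz0 _ _]] := supp (fun=> 0).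
  by rewrite big1 // => a _; rewrite expr0n.
set S := ereal_inf _ => eS.
have SN z : Z z -> (S <= (N z)%:E)%E by move=> Zz; apply: ereal_inf_lbound; exists z.
have [d Ed] : exists d, S = d%:E.
  exists (fine S); rewrite fineK // fin_numElt (lt_trans _ eS) ?ltNyr //=.
  by rewrite (le_lt_trans (SN _ Zz0)) ?ltry.
rewrite Ed lte_fin in eS.
have dN z : Z z -> d <= N z by move=> /SN; rewrite Ed lee_fin.
have d0 : 0 < d by apply: le_lt_trans eS.
pose kap := d * (d - e).
have kap0 : 0 < kap by rewrite mulr_gt0 // subr_gt0.
have W0 : 0 <= W.
  have [|z [_ Wz _]] := supp (fun=> 0); first by rewrite big1 // => a _; rewrite expr0n.
  by apply: le_trans Wz; apply: sumr_ge0 => a _; apply: sqr_ge0.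
(* The infimum d need not be attained, so z is taken within t^2 of it. A step t from z towards the
   test point gains at least 2 t kap to first order, while near-minimality and the squared step
   length, bounded through W, cost at most t^2 K; since t K <= kap, this is a contradiction. *)
pose K := (2 * d + 1) + (2 * W + 2 * (d + 1) ^+ 2).
have K0 : 0 <= K by rewrite /K; have := sqr_ge0 (d + 1); lra.
pose t := kap / (kap + K).
have kK : 0 < kap + K by apply: ltr_wpDr.
have t0 : 0 < t by rewrite divr_gt0.
have t1 : t <= 1 by rewrite ler_pdivrMr // mul1r lerDl.
have [z Zz zt] : exists2 z, Z z & N z < d + t ^+ 2.
  have : (S < (d + t ^+ 2)%:E)%E by rewrite Ed lte_fin ltrDl exprn_gt0.
  by move=> /ereal_inf_lt[_ [z Zz <-]]; rewrite lte_fin => zt; exists z.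
pose r := N z; have rd : d <= r by apply: dN.
have r0 : 0 < r by apply: lt_le_trans rd.
pose v a := Y a - z a.
have vr : \sum_a v a ^+ 2 = r ^+ 2 by rewrite N2.
have [|zs [Zs Ws cs]] := supp (fun a => - v a / r).
  have -> : \sum_a (- v a / r) ^+ 2 = (\sum_a v a ^+ 2) / r ^+ 2.
    by rewrite mulr_suml; apply: eq_bigr => a _; field; rewrite gt_eqF.
  by rewrite vr divff // expf_neq0 // gt_eqF.
have scal (x : {ffun I -> R}) : \sum_a - v a / r * x a = - (\sum_a v a * x a) / r.
  by rewrite -sumrN mulr_suml; apply: eq_bigr => a _; field; rewrite gt_eqF.
rewrite !scal in cs.
have {}cs : \sum_a v a * Y a - \sum_a v a * zs a <= e * r.
  move: cs; rewrite -lerBlDl -(ler_pM2r r0) mulrBl !divfK ?gt_eqF //; lra.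
pose P := \sum_a v a * (zs a - z a).
have PE : P = r ^+ 2 - (\sum_a v a * Y a - \sum_a v a * zs a).
  rewrite -vr -!sumrB; apply: eq_bigr => a _; rewrite /v; ring.
pose D := \sum_a (zs a - z a) ^+ 2.
have t01 : 0 <= t <= 1 by rewrite ltW.
have step : d ^+ 2 <= r ^+ 2 - 2 * t * P + t ^+ 2 * D.
  have -> : r ^+ 2 - 2 * t * P + t ^+ 2 * D =
      N [ffun a => (1 - t) * z a + t * zs a] ^+ 2.
    rewrite N2 -vr /P /D !mulr_sumr -sumrB -big_split; apply: eq_bigr => a _ /=.
    by rewrite ffunE /v; ring.
  by rewrite ler_sqr ?nnegrE ?(ltW d0) // dN //; apply: cvx.
have DK : D <= 2 * W + 2 * r ^+ 2.
  rewrite -vr; apply: (@le_trans _ _ (2 * (\sum_a (Y a - zs a) ^+ 2) + 2 * \sum_a v a ^+ 2)).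
    rewrite !mulr_sumr -big_split; apply: ler_sum => a _ /=; rewrite /v.
    have := sqr_ge0 ((Y a - zs a) + (Y a - z a)); lra.
  by rewrite lerD2r ler_pM2l.
have t21 : t ^+ 2 <= 1 by rewrite exprn_ile1 // ltW.
have rd1 : r <= d + 1 by have := zt; rewrite -/r; lra.
have r2 : r ^+ 2 <= d ^+ 2 + t ^+ 2 * (2 * d + 1).
  have zt' : r <= d + t ^+ 2 by apply: ltW.
  have : r ^+ 2 <= (d + t ^+ 2) ^+ 2.
    by rewrite ler_sqr ?nnegrE ?(ltW r0) // (le_trans _ zt') // ltW.
  have : t ^+ 2 * t ^+ 2 <= t ^+ 2 by rewrite ler_piMr ?sqr_ge0.
  lra.
have D2 : D <= 2 * W + 2 * (d + 1) ^+ 2.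
  have : r ^+ 2 <= (d + 1) ^+ 2 by rewrite ler_sqr ?nnegrE ?(ltW r0) // addr_ge0 // ltW.
  lra.
have PK : 2 * t * P <= t ^+ 2 * K.
  have : t ^+ 2 * D <= t ^+ 2 * (2 * W + 2 * (d + 1) ^+ 2) by rewrite ler_wpM2l ?sqr_ge0.
  rewrite /K; lra.
have kP : kap <= P.
  have : kap <= r * (r - e) by rewrite /kap ler_pM ?subr_ge0 ?lerD2r // ltW.
  rewrite PE expr2; lra.
have : 2 * P <= t * K.
  have E1 : t * (2 * P) = 2 * t * P by ring.
  have E2 : t * (t * K) = t ^+ 2 * K by ring.
  by rewrite -(ler_pM2l t0) E1 E2.
have : t * K <= kap.
  have tk : t * (kap + K) = kap by rewrite divfK // gt_eqF.
  by rewrite -[X in _ <= X]tk ler_pM2l // lerDr ltW.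
lra.
Qed.

End SupportFunction.

Section Asymptotics.
Context (R : realType).

(** For r >= D one has r <= 2 D (r %/ D), so rounding costs a factor sqrt (2 D) only; the added 1
    keeps the constant positive. *)
Lemma O_invsqrt_bound (u : nat -> \bar R) (C : R) (D k : nat) : (0 < D)%N -> 0 <= C ->
  (forall r, (D <= r)%N -> (k <= r)%N ->
     (0 <= u r <= (C / Num.sqrt (r %/ D)%:R)%:E)%E) -> O_invsqrt u.
Proof.
move=> D0 C0 H; split.
  exists (maxn D k) => // r /=; rewrite geq_max => /andP[Dr kr].
  by have /andP[h1 h2] := H r Dr kr; rewrite ge0_fin_numE // (le_lt_trans h2) // ltry.
apply/eqO_exP; exists (C * Num.sqrt (2 * D%:R) + 1);
  first by rewrite ltr_wpDl // mulr_ge0 ?sqrtr_ge0.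
exists (maxn D k) => // r /=; rewrite geq_max => /andP[Dr kr].
have /andP[h1 h2] := H r Dr kr.
have ur : (fine (u r))%:E = u r.
  by rewrite fineK // ge0_fin_numE // (le_lt_trans h2) // ltry.
have N0 : (0 < r %/ D)%N by rewrite divn_gt0.
have r0 : (0 : R) < r%:R by rewrite ltr0n (leq_trans D0).
rewrite ger0_norm; last by rewrite fine_ge0.
rewrite ger0_norm ?invr_ge0 ?sqrtr_ge0 //.
rewrite -lee_fin ur; apply: le_trans h2 _; rewrite lee_fin.
rewrite mulrDl ler_wpDr ?mul1r ?invr_ge0 ?sqrtr_ge0 // -mulrA ler_wpM2l //.
rewrite ler_pdivlMr ?sqrtr_gt0 // mulrC ler_pdivrMr ?sqrtr_gt0 ?ltr0n //.
rewrite -sqrtrM ?mulr_ge0 ?ler0n // ler_wsqrtr // -!natrM ler_nat.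
have := divn_eq r D; have := ltn_pmod r D0; nia.
Qed.

End Asymptotics.

Lemma preordering_ge0 (R : realType) (n c : nat) (q : 'I_c -> {mpoly R[n]}) r p x :
  (forall j, 0 <= peval (q j) x) -> preordering q r p -> 0 <= peval p x.
Proof.
move=> qx [sigma ssigma ->]; rewrite /peval raddf_sum; apply: sumr_ge0 => J Jr /=.
have [_ [h ->]] := ssigma J Jr; rewrite mevalM mulr_ge0 //.
  by rewrite raddf_sum; apply: sumr_ge0 => u _; rewrite /= rmorphXn sqr_ge0.
rewrite /prod_constr rmorph_prod; apply: prodr_ge0 => j _; exact: qx.
Qed.

(** * Rates for pseudo-moments and for the two bounds *)

Section Convergence.
Context (R : realType) (n m : nat) (g : 'I_m -> {mpoly R[n]}) (rad gr : R).
Hypothesis rad0 : 0 < rad.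
Hypothesis X_nonempty : feasible g !=set0.
Hypothesis X_compact : compact (feasible g).
Hypothesis X_ball : feasible g `<=` [set x | enorm x <= rad].
Hypothesis gr0 : 0 <= gr.
Hypothesis growth : forall a, box rad a -> exists2 x, feasible g x &
  dist2 x a <= gr * total_violation g a.

Notation K_ := (@mpolyC n R).
Notation q := (constr rad g).

Let q_ge0 x : feasible g x -> forall j, 0 <= peval (q j) x.
Proof. exact: constr_ge0 X_ball (ltW rad0). Qed.

Lemma riesz_lincomb d (y : {ffun 'N_(n, d) -> R}) k (c : 'N_(n, k) -> R) :
  riesz y (lincomb c) = \sum_a c a * riesz y (mpolyX R a).
Proof. by rewrite riesz_sum; apply: eq_bigr => a _; rewrite rieszCM. Qed.

Lemma cert_rate_r k B : 0 <= B -> exists C D, [/\ 0 <= C, (0 < D)%N &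
  forall r, (D <= r)%N -> forall c : 'N_(n, k) -> R, \sum_a c a ^+ 2 <= B ->
  forall fm, (forall x, feasible g x -> fm <= peval (lincomb c) x) ->
  cert q r (lincomb c - K_ (fm - C / Num.sqrt (r %/ D)%:R))].
Proof.
move=> B0; have [C [D [C0 D0 H]]] := cert_rate rad0 X_ball gr0 growth k B0.
exists C, D; split => // r Dr c cB fm Hfm.
have N0 : (0 < r %/ D)%N by rewrite divn_gt0.
apply: (@cert_mono _ _ _ _ (D * (r %/ D))%N); first by rewrite mulnC leq_divM.
by rewrite rmorphB opprB addrCA addrC; apply: H.
Qed.

Lemma moment_error_rate k : O_invsqrt (fun r => moment_error q (feasible g) k r).
Proof.
have [C [D [C0 D0 H]]] := cert_rate_r k (@ler01 R).
apply: (@O_invsqrt_bound _ _ C D 0%N D0 C0) => r Dr _.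
have [x0 Xx0] := X_nonempty.
have e0 : 0 <= C / Num.sqrt (r %/ D)%:R by rewrite divr_ge0 ?sqrtr_ge0.
(* The supremum could be -oo only if there were no pseudo-moments; the Dirac moments of a feasible
   point exclude this. *)
apply/andP; split.
  apply: le_ereal_sup_tmp; eexists.
    exists [ffun a : 'N_(n, k) => riesz (dirac_moments (2 * r) x0) (mpolyX R a)] => //.
    by exists (dirac_moments (2 * r) x0) => //; apply: dirac_pseudo_moments; exact: q_ge0.
  by apply: le_ereal_inf_tmp => _ [z _ <-]; rewrite lee_fin sqrtr_ge0.
apply: ge_ereal_sup => _ [_ [y My <-] <-].
set Y := [ffun a => _].
(* As a polynomial in x, this is the squared distance from Y to the Dirac moments at x; its maximum
   over the compact X serves as the bound W in [inf_norm2_le]. *)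
pose P := \sum_(a : 'N_(n, k)) (mpolyX R a - K_ (Y a)) ^+ 2.
have PE x : peval P x = \sum_a (Y a - dirac_moments k x a) ^+ 2.
  rewrite /peval raddf_sum; apply: eq_bigr => a _.
  by rewrite /= rmorphXn /= mevalB mevalC [dirac_moments _ _ _]ffunE -/(peval _ _); ring.
have cP : continuous (fun x => - peval P x).
  by move=> x; apply: continuousN; exact: peval_continuous.
have [xW _ HW] := compact_min X_nonempty X_compact cP.
apply: (@inf_norm2_le _ _ _ Y (peval P xW)) => //.
  by move=> u v t; apply: true_moments_convex.
move=> c c1.
(* A linear functional of true moments is least at the Dirac moments of a minimiser of the
   associated polynomial, and the certificate for this minimum bounds the pseudo-moments from
   below. *)
have [xs Xxs xsmin] := compact_min X_nonempty X_compact (@peval_continuous _ _ (lincomb c)).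
exists (dirac_moments k xs); split; first exact: dirac_true_moments.
  by rewrite -PE -lerN2 HW.
have := pseudo_moments_cert My (H r Dr c c1 _ xsmin).
rewrite riesz_subC; case: (My) => -> _ _; rewrite mulr1 riesz_lincomb peval_lincomb subr_ge0.
rewrite lerBlDr; congr (_ <= _ + _); apply: eq_bigr => a _; by rewrite ffunE.
Qed.

(** The certificate bounds both values from below. From above, [mlb] is tested on the Dirac moments
    of a minimiser and [lb] by evaluation there; r >= deg f makes [riesz] see all of f. *)
Lemma value_rate f fmin : is_min (feasible g) (peval f) fmin ->
  O_invsqrt (fun r => fmin%:E - mlb q f r)%E /\ O_invsqrt (fun r => fmin%:E - lb q f r)%E.
Proof.
move=> [[x Xx fx] fge].
pose k := deg f; pose c (a : 'N_(n, k)) := mcoeff a f.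
have fE : lincomb c = f by rewrite [RHS](@mpoly_lowdeg _ _ k).
have B0 : 0 <= \sum_a c a ^+ 2 by apply: sumr_ge0 => a _; apply: sqr_ge0.
have [C [D [C0 D0 H]]] := cert_rate_r k B0.
have {}H r : (D <= r)%N -> cert q r (f - K_ (fmin - C / Num.sqrt (r %/ D)%:R)).
  by move=> Dr; have := H r Dr c (lexx _) fmin; rewrite fE; apply.
have gap (v e : R) (u : \bar R) : ((v - e)%:E <= u)%E -> (u <= v%:E)%E ->
    (0 <= v%:E - u <= e%:E)%E.
  move=> vu uv; have uf : u \is a fin_num.
    by rewrite fin_numElt (lt_le_trans _ vu) ?ltNyr // (le_lt_trans uv) // ltry.
  move: vu uv; rewrite -(fineK uf) -EFinB !lee_fin => vu uv.
  by apply/andP; split; lra.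
split; apply: (@O_invsqrt_bound _ _ C D k D0 C0) => r Dr kr; apply: gap.
- apply: le_ereal_inf_tmp => _ [y My <-]; rewrite lee_fin.
  have := pseudo_moments_cert My (H r Dr).
  by rewrite riesz_subC; case: (My) => -> _ _; rewrite mulr1 subr_ge0.
- apply: ge_ereal_inf; exists (riesz (dirac_moments (2 * r) x) f)%:E.
    by exists (dirac_moments (2 * r) x) => //; apply: dirac_pseudo_moments; exact: q_ge0.
  by rewrite lee_fin riesz_dirac ?fx // (leq_trans kr) // leq_pmull.
- apply: ereal_sup_ubound; exists (fmin - C / Num.sqrt (r %/ D)%:R) => //.
  exact: cert_preordering (H r Dr).
- apply: ge_ereal_sup => _ [a Ha <-]; rewrite lee_fin.
  have := preordering_ge0 (q_ge0 Xx) Ha.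
  by rewrite /peval mevalB mevalC -/(peval _ _) fx subr_ge0.
Qed.

End Convergence.

Theorem theorem4p12 (R : realType) (n m : nat) (g : 'I_m -> {mpoly R[n]})
    (Omega : set 'rV[R]_n) (rad : R)
    (X_nonempty : feasible g !=set0) (X_compact : compact (feasible g))
    (Omega_compact : compact Omega) (Omega_convex : convex_set Omega)
    (X_int : feasible g `<=` interior Omega)
    (rad_ge1 : 1 <= rad)
    (X_ball : feasible g `<=` [set x | enorm x <= rad])
    (growth : strongly_convex_on Omega g \/
              polyak_lojasiewicz (max_violation g)) :
  (forall k : nat,
     O_invsqrt (fun r => moment_error (constr rad g) (feasible g) k r)) /\
  (forall (f : {mpoly R[n]}) (fmin : R), is_min (feasible g) (peval f) fmin ->
     O_invsqrt (fun r => fmin%:E - mlb (constr rad g) f r)%E /\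
     O_invsqrt (fun r => fmin%:E - lb (constr rad g) f r)%E).
Proof.
have rad0 : 0 < rad by apply: lt_le_trans rad_ge1.
have [gr gr0 gr_growth] : exists2 gr : R, 0 <= gr & forall a, box rad a ->
    exists2 x, feasible g x & dist2 x a <= gr * total_violation g a.
  case: growth => [sc|pl].
    exact: strong_growth X_nonempty X_compact Omega_convex X_int (ltW rad0) X_ball sc.
  by have [gr gr0 H] := pl_growth X_nonempty pl; exists gr.
split => [k|f fmin fm]; first exact: moment_error_rate gr_growth k.
exact: value_rate gr_growth f fmin fm.
Qed.
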